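(* Let $p=2$ and let $E=E_1$ be Morava $E$-theory of height $1$ at the prime $2$. Then $$H^s_c(\mathbb{G}_1,E_t)=\begin{cases}\mathbb{Z}_2 & t=0,\ s=0,1,\\ \mathbb{Z}/2^{k+2} & t=2^{k+1}m,\ m\not\equiv0\bmod 2,\ k\ge 1,\ s=1,\\ \mathbb{Z}/2 & t=4t'+2,\ t'\in\mathbb{Z},\ s=1,\\ \mathbb{Z}/2 & s\ge2,\ t\text{ even},\\ 0&\text{otherwise.}\end{cases}$$ Here $m$ ranges over (possibly negative) odd integers and $k$ over integers.
   Context: $E_*=\mathbb{Z}_2[u^{\pm1}]$ with $|u|=-2$. $\mathbb{G}_1=\mathbb{Z}_2^\times\cong\mathbb{Z}_2\times\mathbb{Z}/2$ is the Morava stabilizer group of height 1, acting on $E_*$ by continuous $\mathbb{Z}_2$-algebra automorphisms; concretely $\mathbb{Z}_2^\times$ acts on $E_{2j}\cong\mathbb{Z}_2$ through the character $g\mapsto g^j$ (Adams operations on $2$-complete $K$-theory), and $E_t=0$ for $t$ odd. $E_t$ has the $2$-adic topology. Continuous cohomology: for a topological $\mathbb{G}_1$-module $N$, $H^*_c(\mathbb{G}_1,N)$ is the cohomology of the complex $C^k=\mathrm{Hom}^c(\mathbb{G}_1^k,N)$ ($k\ge0$) of continuous functions with $(df)(g_1,\dots,g_{k+1})=g_1f(g_2,\dots,g_{k+1})+\sum_{j=1}^k(-1)^jf(g_1,\dots,g_jg_{j+1},\dots,g_{k+1})+(-1)^{k+1}f(g_1,\dots,g_k)$. *)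

(* Defs.v *)
From HB Require Import structures.
From mathcomp Require Import all_boot all_order all_algebra ring_quotient.
From mathcomp Require Import all_classical topology tvs.

Set Implicit Arguments.
Unset Strict Implicit.
Unset Printing Implicit Defensive.

Import Order.TTheory GRing.Theory Num.Theory.

Local Open Scope classical_set_scope.
Local Open Scope ring_scope.

(* The reduction map Z/m -> Z/d; only meaningful when d divides m. *)
Definition Zred (m d : nat) (x : 'Z_m) : 'Z_d := (val x)%:R.

Section Zred.
Variables (m d : nat).
Hypotheses (d_gt1 : (1 < d)%N) (m_gt1 : (1 < m)%N) (dm : (d %| m)%N).

Let Zd_modn (k : nat) : ((k %% m)%N%:R : 'Z_d) = k%:R.
Proof.
apply/val_inj; rewrite /= !val_Zp_nat //.
by rewrite modn_dvdm.
Qed.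

Lemma Zred_nat (k : nat) : Zred d (k%:R : 'Z_m) = k%:R.
Proof. by rewrite /Zred /= val_Zp_nat // Zd_modn. Qed.

Lemma ZredD (x y : 'Z_m) : Zred d (x + y) = Zred d x + Zred d y.
Proof. by rewrite -[x]natr_Zp -[y]natr_Zp -natrD !Zred_nat natrD. Qed.

Lemma ZredM (x y : 'Z_m) : Zred d (x * y) = Zred d x * Zred d y.
Proof. by rewrite -[x]natr_Zp -[y]natr_Zp -natrM !Zred_nat natrM. Qed.

Lemma ZredN (x : 'Z_m) : Zred d (- x) = - Zred d x.
Proof. by apply/eqP; rewrite -addr_eq0 -ZredD addNr (Zred_nat 0). Qed.

End Zred.

(* The 2-adic integers, as the limit of the rings Z/2^(n+1), n >= 0; indices
   start at Z/2 because 'Z_1 is not the zero ring. *)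
Record Z2 := MkZ2 {
  level :> forall n, 'Z_(2 ^ n.+1);
  level_coherent : forall n, Zred (2 ^ n.+1) (level n.+1) = level n }.

Lemma Z2P (x y : Z2) : (forall n, x n = y n) -> x = y.
Proof.
case: x y => [x cx] [y cy] /= xy.
have exy : x = y by apply: functional_extensionality_dep.
by case: y / exy cy {xy} => cy; congr MkZ2; exact: Prop_irrelevance.
Qed.

Section Z2Ring.

Let expn2_gt1 n : (1 < 2 ^ n.+1)%N. Proof. by rewrite -{1}(expn0 2) ltn_exp2l. Qed.
Let expn2_dvd n : (2 ^ n.+1 %| 2 ^ n.+2)%N. Proof. by rewrite dvdn_exp2l. Qed.
Let H := (expn2_gt1, expn2_dvd).

Fact Z2_zero_subproof n : Zred (2 ^ n.+1) (0 : 'Z_(2 ^ n.+2)) = 0.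
Proof. by rewrite (Zred_nat _ _ _ 0) ?H. Qed.
Fact Z2_one_subproof n : Zred (2 ^ n.+1) (1 : 'Z_(2 ^ n.+2)) = 1.
Proof. by rewrite (Zred_nat _ _ _ 1) ?H. Qed.
Fact Z2_opp_subproof (x : Z2) n : Zred (2 ^ n.+1) (- x n.+1) = - x n.
Proof. by rewrite ZredN ?H // level_coherent. Qed.
Fact Z2_add_subproof (x y : Z2) n :
  Zred (2 ^ n.+1) (x n.+1 + y n.+1) = x n + y n.
Proof. by rewrite ZredD ?H // !level_coherent. Qed.
Fact Z2_mul_subproof (x y : Z2) n :
  Zred (2 ^ n.+1) (x n.+1 * y n.+1) = x n * y n.
Proof. by rewrite ZredM ?H // !level_coherent. Qed.

Definition Z2_zero := MkZ2 Z2_zero_subproof.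
Definition Z2_one := MkZ2 Z2_one_subproof.
Definition Z2_opp x := MkZ2 (Z2_opp_subproof x).
Definition Z2_add x y := MkZ2 (Z2_add_subproof x y).
Definition Z2_mul x y := MkZ2 (Z2_mul_subproof x y).

HB.instance Definition _ := gen_eqMixin Z2.
HB.instance Definition _ := gen_choiceMixin Z2.

Fact Z2_addA : associative Z2_add.
Proof. by move=> x y z; apply: Z2P => n /=; rewrite addrA. Qed.
Fact Z2_addC : commutative Z2_add.
Proof. by move=> x y; apply: Z2P => n /=; rewrite addrC. Qed.
Fact Z2_add0 : left_id Z2_zero Z2_add.
Proof. by move=> x; apply: Z2P => n /=; rewrite add0r. Qed.
Fact Z2_addN : left_inverse Z2_zero Z2_opp Z2_add.
Proof. by move=> x; apply: Z2P => n /=; rewrite addNr. Qed.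

HB.instance Definition _ :=
  GRing.isZmodule.Build Z2 Z2_addA Z2_addC Z2_add0 Z2_addN.

Fact Z2_mulA : associative Z2_mul.
Proof. by move=> x y z; apply: Z2P => n /=; rewrite mulrA. Qed.
Fact Z2_mulC : commutative Z2_mul.
Proof. by move=> x y; apply: Z2P => n /=; rewrite mulrC. Qed.
Fact Z2_mul1 : left_id Z2_one Z2_mul.
Proof. by move=> x; apply: Z2P => n /=; rewrite mul1r. Qed.
Fact Z2_mulD : left_distributive Z2_mul +%R.
Proof. by move=> x y z; apply: Z2P => n /=; rewrite mulrDl. Qed.
Fact Z2_one_neq0 : Z2_one != 0 :> Z2.
Proof.
apply/eqP => /(congr1 (fun x : Z2 => x 0%N)) /= /eqP.
by rewrite (oner_eq0 'Z_2).
Qed.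

HB.instance Definition _ := GRing.Zmodule_isComNzRing.Build Z2
  Z2_mulA Z2_mulC Z2_mul1 Z2_mulD Z2_one_neq0.

Lemma Z2_levelD (x y : Z2) n : (x + y) n = x n + y n. Proof. by []. Qed.
Lemma Z2_levelM (x y : Z2) n : (x * y) n = x n * y n. Proof. by []. Qed.

Definition Z2_unit : {pred Z2} := [pred x | `[< exists y, y * x = 1 >]].
Definition Z2_inv (x : Z2) : Z2 :=
  if pselect (exists y, y * x = 1) is left ex then projT1 (cid ex) else x.

Fact Z2_mulVx : {in Z2_unit, left_inverse 1 Z2_inv *%R}.
Proof.
move=> x /asboolP ux; rewrite /Z2_inv; case: pselect => // ex.
exact: projT2 (cid ex).
Qed.
Fact Z2_unitPl (x y : Z2) : y * x = 1 -> Z2_unit x.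
Proof. by move=> yx; apply/asboolP; exists y. Qed.
Fact Z2_inv_out : {in [predC Z2_unit], Z2_inv =1 id}.
Proof. by move=> x /asboolP nux; rewrite /Z2_inv; case: pselect. Qed.

HB.instance Definition _ :=
  GRing.ComNzRing_hasMulInverse.Build Z2 Z2_mulVx Z2_unitPl Z2_inv_out.

End Z2Ring.

(* The 2-adic topology on an abelian group M: the subgroups 2^n M form a basis
   of neighborhoods of 0. *)
Definition adic2_nbhs (M : zmodType) (x : M) : set_system M :=
  [set A | exists n, forall y, A (x + y *+ 2 ^ n)].

Arguments adic2_nbhs {M} x.

Section Adic2.
Variable M : zmodType.
Implicit Types (x : M) (A : set M).

Lemma adic2_nbhs_filter x : ProperFilter (adic2_nbhs x).
Proof.
have sub n m (A : set M) : (n <= m)%N ->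
    (forall y, A (x + y *+ 2 ^ n)) -> forall y, A (x + y *+ 2 ^ m).
  by move=> /subnKC <- An y; rewrite expnD mulnC mulrnA; exact: An.
split; first by case=> n /(_ 0).
split; first by exists 0%N.
- move=> A B [n An] [m Bm]; exists (maxn n m) => y.
  by split; [apply: sub An _ | apply: sub Bm _]; rewrite (leq_maxl, leq_maxr).
- by move=> A B AB [n An]; exists n => y; exact: AB.
Qed.

Lemma adic2_nbhs_singleton x A : adic2_nbhs x A -> A x.
Proof. by case=> n /(_ 0); rewrite mul0rn addr0. Qed.

Lemma adic2_nbhs_nbhs x A : adic2_nbhs x A -> adic2_nbhs x (adic2_nbhs^~ A).
Proof. by case=> n An; exists n => y; exists n => z; rewrite -addrA -mulrnDl. Qed.

End Adic2.

HB.instance Definition _ := hasNbhs.Build Z2 (@adic2_nbhs Z2).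
HB.instance Definition _ := Nbhs_isNbhsTopological.Build Z2
  (@adic2_nbhs_filter Z2) (@adic2_nbhs_singleton Z2) (@adic2_nbhs_nbhs Z2).

HB.mixin Record isTopologicalGroup G of Group G & Topological G := {
  mulg_continuous : continuous (fun p : G * G => (p.1 * p.2)%g);
  invg_continuous : continuous (fun x : G => x^-1%g) }.

#[short(type="topologicalGroupType")]
HB.structure Definition TopologicalGroup :=
  {G of Group G & Topological G & isTopologicalGroup G}.

(* Z_2^* with the subspace topology of Z_2. Inversion is continuous for it
   (G1inv_continuous), so it is also the topology of units of a topological
   ring. *)
Record G1 := MkG1 { G1val : Z2; G1valP : G1val \is a GRing.unit }.

HB.instance Definition _ := [isSub for G1val].
HB.instance Definition _ := [Choice of G1 by <:].

Section G1Group.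
Implicit Types x y : G1.

Fact G1_mul_subproof x y : val x * val y \is a GRing.unit.
Proof. by rewrite unitrM (valP x) (valP y). Qed.
Fact G1_inv_subproof x : (val x)^-1 \is a GRing.unit.
Proof. by rewrite unitrV (valP x). Qed.

Definition G1_one : G1 := MkG1 (unitr1 Z2).
Definition G1_mul x y : G1 := MkG1 (G1_mul_subproof x y).
Definition G1_inv x : G1 := MkG1 (G1_inv_subproof x).

Fact G1_mulA : associative G1_mul.
Proof. by move=> x y z; apply: val_inj; exact: mulrA. Qed.
Fact G1_mul1 : left_id G1_one G1_mul.
Proof. by move=> x; apply: val_inj; exact: mul1r. Qed.
Fact G1_mulx1 : right_id G1_one G1_mul.
Proof. by move=> x; apply: val_inj; exact: mulr1. Qed.
Fact G1_mulV : left_inverse G1_one G1_inv G1_mul.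
Proof. by move=> x; apply: val_inj; exact: mulVr (valP x). Qed.
Fact G1_mulxV : right_inverse G1_one G1_inv G1_mul.
Proof. by move=> x; apply: val_inj; exact: divrr (valP x). Qed.

HB.instance Definition _ := isGroup.Build G1
  G1_mulA G1_mul1 G1_mulx1 G1_mulV G1_mulxV.

End G1Group.

HB.instance Definition _ := Topological.copy G1 (initial_topology (val : G1 -> Z2)).


Lemma continuous_comp2 (T U V W : topologicalType) (op : U -> V -> W)
    (f : T -> U) (g : T -> V) :
  continuous f -> continuous g -> continuous (fun p : U * V => op p.1 p.2) ->
  continuous (fun x => op (f x) (g x)).
Proof.
move=> cf cg cop x.
apply: (@continuous_comp _ _ _ (fun x => (f x, g x)) (fun p => op p.1 p.2)).
  by apply: cvg_pair; [exact: cf | exact: cg].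
exact: cop.
Qed.

Lemma adic2_nbhs_ball (M : zmodType) (x : M) n :
  adic2_nbhs x [set x + y *+ 2 ^ n | y in setT].
Proof. by exists n => y; exists y. Qed.

Section G1Topology.

Lemma Z2_mul_continuous : continuous (fun p : Z2 * Z2 => p.1 * p.2).
Proof.
move=> [a b] A [n An].
exists ([set a + y *+ 2 ^ n | y in setT], [set b + y *+ 2 ^ n | y in setT]).
  by split; exact: adic2_nbhs_ball.
move=> [_ _] [/= [u _ <-] [v _ <-]].
have := An (a * v + u * (b + v *+ 2 ^ n)); rewrite mulrnDl -mulrnAr -mulrnAl.
by rewrite addrA -mulrDr -mulrDl.
Qed.

Lemma G1val_continuous : continuous (val : G1 -> Z2).
Proof. exact: initial_continuous. Qed.

Lemma G1inv_continuous : continuous (fun g : G1 => (val g)^-1).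
Proof.
move=> g A [n An].
have ghn := @G1val_continuous g _ (adic2_nbhs_ball (val g) n).
apply: (@filterS _ (nbhs g) _ _ _ _ ghn) => h /= [y _ gh].
have hU := valP h; have gU := valP g.
suff -> : (val h)^-1 = (val g)^-1 + (- ((val g)^-1 * (val h)^-1 * y)) *+ 2 ^ n.
  exact: An.
rewrite mulNrn -mulrnAr; have -> : y *+ 2 ^ n = val h - val g.
  by rewrite /= -gh addrC addKr.
rewrite mulrBr -mulrA mulVr // mulr1 mulrAC mulVr // mul1r opprB.
by rewrite addrC subrK.
Qed.

Fact G1_mul_continuous : continuous (fun p : G1 * G1 => (p.1 * p.2)%g).
Proof.
apply: continuous_comp_initial.
rewrite -[_ \o _]/(fun p : G1 * G1 => val p.1 * val p.2).
apply: (@continuous_comp2 (G1 * G1)%type Z2 Z2 Z2 *%R (fun p => val p.1)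
  (fun p => val p.2) _ _ Z2_mul_continuous) => p.
  by apply: continuous_comp; [exact: cvg_fst | exact: G1val_continuous].
by apply: continuous_comp; [exact: cvg_snd | exact: G1val_continuous].
Qed.

Fact G1_inv_continuous : continuous (fun x : G1 => x^-1%g).
Proof. apply: continuous_comp_initial; exact: G1inv_continuous. Qed.

HB.instance Definition _ :=
  isTopologicalGroup.Build G1 G1_mul_continuous G1_inv_continuous.

Lemma G1_exprz_continuous (j : int) : continuous (fun g : G1 => val g ^ j).
Proof.
have expn (f : G1 -> Z2) n : continuous f -> continuous (fun g => f g ^+ n).
  move=> cf; elim: n => [|n IHn]; first exact: (@cst_continuous _ _ (1 : Z2)).
  under eq_fun do rewrite exprS.
  exact: continuous_comp2 Z2_mul_continuous.
case: j => n; first exact/expn/G1val_continuous.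
under eq_fun do rewrite NegzE -exprz_inv.
exact/expn/G1inv_continuous.
Qed.

End G1Topology.

Record topGModType (G : topologicalGroupType) := TopGMod {
  gmod_sort :> topologicalZmodType;
  gact : G -> gmod_sort -> gmod_sort;
  gact1 : forall x, gact 1%g x = x;
  gactM : forall g h x, gact (g * h)%g x = gact g (gact h x);
  gactD : forall g x y, gact g (x + y) = gact g x + gact g y;
  gact_continuous : continuous (fun p : G * gmod_sort => gact p.1 p.2) }.

Section ContinuousCohomology.
Variables (G : topologicalGroupType) (N : topGModType G).

Definition continuous_fct k : {pred {ptws 'I_k -> G} -> N} :=
  [pred f | `[< continuous f >]].

Fact continuous_fct_zmod_closed k : zmod_closed (@continuous_fct k).
Proof.
split=> [|f g /asboolP cf /asboolP cg]; apply/asboolP.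
  exact: (@cst_continuous _ _ (0 : N)).
have := @continuous_comp2 _ _ _ _ (fun a b : N => a - b) _ _ cf cg.
by move=> /(_ (@sub_continuous N)).
Qed.

HB.instance Definition _ k :=
  GRing.isZmodClosed.Build _ (@continuous_fct k) (@continuous_fct_zmod_closed k).

(* The group C^k of continuous functions G^k -> N. *)
Record cochain (k : nat) := Cochain {
  cochain_fun :> {ptws 'I_k -> G} -> N;
  cochainP : cochain_fun \in @continuous_fct k }.

HB.instance Definition _ k := [isSub for @cochain_fun k].
HB.instance Definition _ k := [Choice of cochain k by <:].
HB.instance Definition _ k := [SubChoice_isSubZmodule of cochain k by <:].

(* (g_0, ..., g_k) |-> (g_0, ..., g_j g_(j+1), ..., g_k) *)
Definition merge k (j : 'I_k) (g : 'I_k.+1 -> G) : 'I_k -> G := fun i =>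
  let gi := g (widen_ord (leqnSn k) i) in
  let gSi := g (lift ord0 i) in
  if (i < j)%N then gi else if i == j then (gi * gSi)%g else gSi.

(* With indices starting at 0, the j-th inner face has sign (-1)^(j+1). *)
Definition cdiff_fun k (f : {ptws 'I_k -> G} -> N) : {ptws 'I_k.+1 -> G} -> N :=
  fun g => gact (g ord0) (f (fun i => g (lift ord0 i)))
    + \sum_(j < k) f (merge j g) *~ (-1) ^+ j.+1
    + f (fun i => g (widen_ord (leqnSn k) i)) *~ (-1) ^+ k.+1.

Lemma ptws_continuous (T U : topologicalType) (I : Type) (f : T -> {ptws I -> U}) :
  (forall i, continuous (fun x => f x i)) -> continuous f.
Proof.
move=> cf x; apply/cvg_sup => i.
exact: (@continuous_comp_initial _ _ _ (fun h : forall _ : I, U => h i) f (cf i)).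
Qed.

Lemma cdiff_fun_continuous k (f : {ptws 'I_k -> G} -> N) :
  continuous f -> continuous (cdiff_fun f).
Proof.
move=> cf.
have ev i : continuous (fun g : {ptws 'I_k.+1 -> G} => g i).
  exact: (@proj_continuous _ (fun _ : 'I_k.+1 => G) i).
have cadd (T : topologicalType) (a b : T -> N) :
    continuous a -> continuous b -> continuous (fun x => a x + b x).
  move=> ca cb; have := @continuous_comp2 _ _ _ _ (fun a b : N => a + b) _ _ ca cb.
  by move=> /(_ (@add_continuous N)).
have cmulz (T : topologicalType) (a : T -> N) n :
    continuous a -> continuous (fun x => a x *~ (-1) ^+ n).
  move=> ca; rewrite -signr_odd; case: (odd n).
    under eq_fun do rewrite expr1 mulrNz mulr1z.
    by move=> x; apply: continuous_comp; [exact: ca | exact: opp_continuous].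
  by under eq_fun do rewrite expr0 mulr1z.
have csum (T : topologicalType) (I : Type) (r : seq I) (a : I -> T -> N) :
    (forall i, continuous (a i)) -> continuous (fun x => \sum_(i <- r) a i x).
  move=> ca; elim: r => [|i r IHr].
    by under eq_fun do rewrite big_nil; exact: (@cst_continuous _ _ (0 : N)).
  by under eq_fun do rewrite big_cons; exact: cadd.
have ccomp (m : {ptws 'I_k.+1 -> G} -> {ptws 'I_k -> G}) :
    (forall i, continuous (fun g => m g i)) -> continuous (fun g => f (m g)).
  move=> cm x; apply: continuous_comp; last exact: cf.
  exact: ptws_continuous.
apply: (cadd); first apply: (cadd).
- apply: (@continuous_comp2 _ _ _ _ (@gact _ N) _ _ _ _ (@gact_continuous _ N)).
    exact: ev.
  by apply: ccomp => i; exact: ev.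
- apply: csum => j; apply/cmulz/ccomp => i; rewrite /merge.
  case: (i < j)%N; first exact: ev.
  case: (i == j); last exact: ev.
  exact: (@continuous_comp2 _ _ _ _ *%g _ _ (ev _) (ev _) (@mulg_continuous G)).
- by apply/cmulz/ccomp => i; exact: ev.
Qed.

Fact cdiff_subproof k (f : cochain k) : cdiff_fun f \in @continuous_fct k.+1.
Proof. by apply/asboolP/cdiff_fun_continuous/asboolP; exact: cochainP. Qed.

Definition cdiff k (f : cochain k) : cochain k.+1 := Cochain (cdiff_subproof f).

Fact cdiff_is_zmod_morphism k : zmod_morphism (@cdiff k).
Proof.
move=> f h; apply/val_inj/funext => g; rewrite /= /cdiff_fun /=.
have gactB x y z : gact x (y - z) = gact x y - gact x z :> N.
  by apply/(addIr (gact x z)); rewrite -gactD !subrK.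
rewrite gactB mulrzBl; under eq_bigr do rewrite mulrzBl.
have add3 (a a' b b' c c' : N) :
    a - a' + (b - b') + (c - c') = a + b + c - (a' + b' + c').
  by rewrite !opprD (addrACA a) (addrACA (a + b)).
by rewrite sumrB add3.
Qed.

HB.instance Definition _ k :=
  GRing.isZmodMorphism.Build _ _ (@cdiff k) (@cdiff_is_zmod_morphism k).

Definition is_cocycle k : {pred cochain k} := [pred f | cdiff f == 0].

Fact is_cocycle_zmod_closed k : zmod_closed (@is_cocycle k).
Proof.
split=> [|f g]; rewrite !unfold_in ?raddf0 // => /eqP df /eqP dg.
by rewrite raddfB /= df dg subrr.
Qed.

HB.instance Definition _ k :=
  GRing.isZmodClosed.Build _ (@is_cocycle k) (@is_cocycle_zmod_closed k).

Record cocycle (k : nat) := Cocycle {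
  cocycle_val :> cochain k;
  cocycleP : cocycle_val \in @is_cocycle k }.

HB.instance Definition _ k := [isSub for @cocycle_val k].
HB.instance Definition _ k := [Choice of cocycle k by <:].
HB.instance Definition _ k := [SubChoice_isSubZmodule of cocycle k by <:].

Definition is_coboundary k : {pred cocycle k} :=
  match k return {pred cocycle k} with
  | 0 => [pred z | z == 0]
  | k'.+1 => [pred z | `[< exists f : cochain k', cdiff f = cocycle_val z >]]
  end.

Fact is_coboundary_zmod_closed k : zmod_closed (@is_coboundary k).
Proof.
case: k => [|k].
  split=> [|f g]; rewrite !unfold_in //= => /eqP -> /eqP ->.
  by rewrite subr0.
split=> [|z w /asboolP[f fz] /asboolP[g gw]]; apply/asboolP.
  by exists 0; rewrite raddf0.
by exists (f - g); rewrite raddfB /= fz gw.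
Qed.

HB.instance Definition _ k := GRing.isZmodClosed.Build _
  (@is_coboundary k) (@is_coboundary_zmod_closed k).

Definition cohomology (k : nat) : zmodType := Quotient.quot (@is_coboundary k).

End ContinuousCohomology.

(* The degree t part of Z_2[u, u^-1] with u in degree -2: an element a u^(-t/2)
   is given by its coefficient a, and only 0 is allowed if t is odd. *)
Definition in_degree (t : int) : {pred Z2^o} := [pred a | (2 %| t)%Z || (a == 0)].

Fact in_degree_submod_closed t : submod_closed (in_degree t).
Proof.
rewrite /in_degree; case: (2 %| t)%Z; split=> [|a x y] //.
  exact: eqxx.
move=> x0 y0; have {x0}-> : x = 0 by apply/eqP.
by have {y0}-> : y = 0 by [apply/eqP]; rewrite scaler0 addr0; exact: eqxx.
Qed.

HB.instance Definition _ t :=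
  GRing.isSubmodClosed.Build _ _ (in_degree t) (in_degree_submod_closed t).

Record E (t : int) := MkE { coef :> Z2^o; coefP : coef \in in_degree t }.

HB.instance Definition _ t := [isSub for @coef t].
HB.instance Definition _ t := [Choice of E t by <:].
HB.instance Definition _ t := [SubChoice_isSubLmodule of E t by <:].

HB.instance Definition _ t := hasNbhs.Build (E t) (@adic2_nbhs (E t)).
HB.instance Definition _ t := Nbhs_isNbhsTopological.Build (E t)
  (@adic2_nbhs_filter (E t)) (@adic2_nbhs_singleton (E t))
  (@adic2_nbhs_nbhs (E t)).

Fact E_sub_continuous t : continuous (fun p : E t * E t => p.1 - p.2).
Proof.
move=> [a b] A [n An].
exists ([set a + y *+ 2 ^ n | y in setT], [set b + y *+ 2 ^ n | y in setT]).
  by split; exact: adic2_nbhs_ball.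
move=> [_ _] [/= [u _ <-] [v _ <-]].
by rewrite opprD addrACA -mulrnBl; exact: An.
Qed.

HB.instance Definition _ t :=
  PreTopologicalNmodule_isTopologicalZmodule.Build (E t) (@E_sub_continuous t).

Fact E_scale_continuous t : continuous (fun p : Z2 * E t => p.1 *: p.2).
Proof.
move=> [a b] A [n An].
exists ([set a + y *+ 2 ^ n | y in setT], [set b + y *+ 2 ^ n | y in setT]).
  by split; exact: adic2_nbhs_ball.
move=> [_ _] [/= [u _ <-] [v _ <-]].
have := An (a *: v + u *: (b + v *+ 2 ^ n)).
by rewrite mulrnDl scalerMnr scalerMnl addrA -scalerDr -scalerDl.
Qed.

(* The action of g in Z_2^* on E_t, multiplication by g^j for t = 2j. *)
Definition E_act t (g : G1) (x : E t) : E t := val g ^ (t %/ 2)%Z *: x.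

Section EAction.
Variable t : int.
Implicit Types (g h : G1) (x y : E t).

Fact E_act1 x : E_act 1%g x = x.
Proof. by rewrite /E_act exp1rz scale1r. Qed.

Fact E_actM g h x : E_act (g * h)%g x = E_act g (E_act h x).
Proof.
rewrite /E_act scalerA; congr (_ *: _).
apply: exprMz_comm; [exact: valP g | exact: valP h | exact: mulrC].
Qed.

Fact E_actD g x y : E_act g (x + y) = E_act g x + E_act g y.
Proof. exact: scalerDr. Qed.

Fact E_act_continuous : continuous (fun p : G1 * E t => E_act p.1 p.2).
Proof.
apply: (@continuous_comp2 (G1 * E t)%type Z2 (E t) (E t) *:%R
  (fun p => val p.1 ^ (t %/ 2)%Z) snd _ _ (@E_scale_continuous t)) => p.
  apply: (@continuous_comp _ _ _ fst (fun g : G1 => val g ^ (t %/ 2)%Z)).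
    exact: cvg_fst.
  exact: G1_exprz_continuous.
exact: cvg_snd.
Qed.

Definition E_mod : topGModType G1 := TopGMod E_act1 E_actM E_actD E_act_continuous.

End EAction.

Definition zmod_iso (A B : zmodType) : Prop :=
  exists f : {additive A -> B}, bijective f.

(* Main.v *)
(* Let sigma be the action of -1, phi that of the topological generator 5 of
   1 + 4 Z_2, and j = t / 2. Since Z_2^* = {1, -1} x 5^(Z_2), the cohomology of N
   is that of a small complex T(N), the tensor product of phi - 1 : N -> N with
   the complex N -> N -> N -> ... whose maps are alternately sigma - 1 and
   sigma + 1. It is compared with the bar complex through a double complex:
   T applied to the bar complex with coefficients in the coinduced module of
   continuous functions F(x). Its columns are exact by evaluation at x = 1. Its
   rows are exact because {x = 1 mod 4} is a fundamental domain for sigma, and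
   because phi - 1 is onto: summation along the orbits of 5 extends by
   continuity. The kernels at the edges are C^*(G, Z_2(j)) and T(Z_2(j)), and a
   zigzag identifies the two cohomologies. On Z_2(j), sigma - 1 and sigma + 1
   are 0 and +-2, and phi - 1 is 5^j - 1, which is 2^(v_2(j) + 2) times a unit
   for j <> 0. *)
Require Import Defs.
From HB Require Import structures.
From mathcomp Require Import all_boot all_order all_algebra ring_quotient.
From mathcomp Require Import ring zify.
From mathcomp Require Import all_classical topology tvs.

Set Implicit Arguments.
Unset Strict Implicit.
Unset Printing Implicit Defensive.

Import Order.TTheory GRing.Theory Num.Theory.

Local Open Scope ring_scope.

(** * Arithmetic of Z_2 *)

Lemma expn2S_gt1 n : (1 < 2 ^ n.+1)%N.
Proof. by rewrite -{1}(expn0 2) ltn_exp2l. Qed.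

Lemma eq_natZp (m k l : nat) : (1 < m)%N ->
  (k%:R = l%:R :> 'Z_m) <-> k = l %[mod m].
Proof.
move=> m_gt1; split=> [/(congr1 val)|kl]; first by rewrite /= !val_Zp_nat.
by rewrite -(Zp_nat_mod m_gt1 k) kl Zp_nat_mod.
Qed.

Lemma Z2_level_nat n k : (k%:R : Z2) n = k%:R.
Proof. by elim: k => [|k IHk] //; rewrite !mulrS Z2_levelD IHk. Qed.

Lemma Z2_lift (a : nat -> nat) :
  (forall n, a n.+1 = a n %[mod 2 ^ n.+1]) ->
  exists x : Z2, forall n, x n = (a n)%:R.
Proof.
move=> aE; unshelve eexists.
  apply: (@MkZ2 (fun n => (a n)%:R)) => n.
  rewrite Zred_nat ?expn2S_gt1 ?dvdn_exp2l //.
  by apply/eq_natZp; rewrite ?expn2S_gt1.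
by [].
Qed.

(* Valued in nat, to avoid rewriting in the dependent type of [x n]. *)
Definition residue (x : Z2) n : nat := val (x n).

Lemma residueE x n : (residue x n)%:R = x n.
Proof. exact: natr_Zp. Qed.

Lemma ltn_residue x n : (residue x n < 2 ^ n.+1)%N.
Proof.
rewrite -[X in (_ < X)%N](Zp_cast (expn2S_gt1 n)); exact: ltn_ord.
Qed.

Lemma residue_coherent (x : Z2) n k :
  residue x (n + k) = residue x n %[mod 2 ^ n.+1].
Proof.
elim: k => [|k IHk]; first by rewrite addn0.
have step : (residue x (n + k).+1 %% 2 ^ (n + k).+1 = residue x (n + k))%N.
  have /(congr1 val) := level_coherent x (n + k).
  by rewrite /Zred /= val_Zp_nat ?expn2S_gt1.
by rewrite -IHk addnS -step modn_dvdm // dvdn_exp2l // ltnS leq_addr.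
Qed.

(** Congruence modulo 2^n with an explicit quotient, so that [ring] proves the compatibilities.
    Since levels start at Z/2, level [n] corresponds to [cong n.+1]. *)
Definition cong n (x y : Z2) := exists z, x = y + 2 ^+ n * z.

Lemma exp2rE n : (2 ^ n)%N%:R = 2 ^+ n :> Z2.
Proof. by rewrite natrX. Qed.

(** Dividing the residue of [x] at level n + 1 + k by 2^(n+1) gives level k of the quotient. *)
Lemma Z2_divisible n (x : Z2) : x n = 0 -> exists z, x = 2 ^+ n.+1 * z.
Proof.
move=> xn0; pose a k := (residue x (n.+1 + k)%N %/ 2 ^ n.+1)%N.
have aE k : (residue x (n.+1 + k) = 2 ^ n.+1 * a k)%N.
  rewrite mulnC divnK // /dvdn addSn -addnS residue_coherent.
  by rewrite /residue xn0 mod0n.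
have [z zE] : exists z : Z2, forall k, z k = (a k)%:R.
  apply: Z2_lift => k; apply/eqP.
  have /eqP := residue_coherent x (n.+1 + k) 1.
  rewrite addn1 -addnS !aE expnD -!muln_modr.
  by rewrite eqn_mul2l expn_eq0.
exists z; apply: Z2P => k.
rewrite -exp2rE Z2_levelM Z2_level_nat zE -natrM -residueE.
apply/eq_natZp; rewrite ?expn2S_gt1 //.
by have := residue_coherent x k n.+1; rewrite addnC aE => ->.
Qed.

Lemma cong_level n x y : cong n.+1 x y <-> x n = y n.
Proof.
split=> [[z ->]|xy]; last first.
  have [|z zE] := @Z2_divisible n (x - y).
    by rewrite Z2_levelD xy -Z2_levelD subrr.
  by exists z; rewrite -zE addrC subrK.
rewrite Z2_levelD Z2_levelM -exp2rE Z2_level_nat.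
by rewrite pchar_Zp ?expn2S_gt1 // mul0r addr0.
Qed.

Lemma cong0 x y : cong 0 x y.
Proof. by exists (x - y); rewrite expr0; ring. Qed.

Lemma cong_refl n x : cong n x x.
Proof. by exists 0; ring. Qed.

Lemma cong_sym n x y : cong n x y -> cong n y x.
Proof. by case=> z ->; exists (- z); ring. Qed.

Lemma cong_trans n y x z : cong n x y -> cong n y z -> cong n x z.
Proof. by case=> a -> [b ->]; exists (a + b); ring. Qed.

Lemma congD n x y x' y' : cong n x y -> cong n x' y' -> cong n (x + x') (y + y').
Proof. by case=> a -> [b ->]; exists (a + b); ring. Qed.

Lemma congN n x y : cong n x y -> cong n (- x) (- y).
Proof. by case=> a ->; exists (- a); ring. Qed.

Lemma congB n x y x' y' : cong n x y -> cong n x' y' -> cong n (x - x') (y - y').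
Proof. by move=> xy /congN; apply: congD. Qed.

Lemma congM n x y x' y' : cong n x y -> cong n x' y' -> cong n (x * x') (y * y').
Proof.
by case=> a -> [b ->]; exists (a * y' + y * b + 2 ^+ n * a * b); ring.
Qed.

Lemma congX n x y k : cong n x y -> cong n (x ^+ k) (y ^+ k).
Proof.
move=> xy; elim: k => [|k IHk]; first exact: cong_refl.
by rewrite !exprS; apply: congM.
Qed.

Lemma cong_sum n (I : Type) (r : seq I) (F H : I -> Z2) :
  (forall i, cong n (F i) (H i)) ->
  cong n (\sum_(i <- r) F i) (\sum_(i <- r) H i).
Proof.
move=> FH; elim/big_ind2: _ => //; first exact: cong_refl.
by move=> *; apply: congD.
Qed.

Lemma cong_weaken m n x y : (m <= n)%N -> cong n x y -> cong m x y.
Proof.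
by move=> /subnKC <- [z ->]; exists (2 ^+ (n - m) * z); rewrite exprD mulrA.
Qed.

Lemma cong_eq x y : (forall n, cong n x y) -> x = y.
Proof. by move=> xy; apply: Z2P => n; apply/cong_level. Qed.

Lemma cong_lim (z : nat -> Z2) : (forall n, cong n (z n.+1) (z n)) ->
  exists l, forall n, cong n l (z n).
Proof.
(* Level [n] of the limit lives modulo 2^(n+1), so it is read off from [z n.+1]. *)
move=> zE; have [|l lE] := @Z2_lift (fun n => residue (z n.+1) n).
  move=> n; apply/eq_natZp; rewrite ?expn2S_gt1 // residueE.
  have /cong_level <- := zE n.+1; rewrite -[RHS]residueE.
  apply/eq_natZp; rewrite ?expn2S_gt1 //.
  by have := residue_coherent (z n.+2) n 1; rewrite addn1.
exists l => -[|n]; first exact: cong0.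
by apply/cong_level; rewrite lE residueE.
Qed.

Lemma cong_residue n x : exists2 k, (k < 2 ^ n)%N & cong n x k%:R.
Proof.
case: n => [|n]; first by exists 0%N => //; apply: cong0.
exists (residue x n); first exact: ltn_residue.
by apply/cong_level; rewrite Z2_level_nat residueE.
Qed.

(** At the cost of one level: 2x = 0 modulo 2^(n+2) gives x = 0 modulo 2^(n+1). *)
Lemma Z2_mul2I (x y : Z2) : 2 * x = 2 * y -> x = y.
Proof.
move=> /eqP; rewrite -subr_eq0 -mulrBr => /eqP xy0; apply/eqP.
rewrite -subr_eq0; apply/eqP; move: (x - y) xy0 => {x y} x x0.
apply: Z2P => n; rewrite -[x n]residueE -[RHS]/(0%:R).
apply/eq_natZp; rewrite ?expn2S_gt1 //.
have := residue_coherent x n 1; rewrite addn1 => <-.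
have /(congr1 (fun z : Z2 => z n.+1)) := x0.
rewrite Z2_levelM (Z2_level_nat _ 2) -[x n.+1]residueE -natrM -[RHS]/(0%:R).
move=> /eq_natZp; rewrite ?expn2S_gt1 // => /(_ isT) /eqP.
by rewrite mod0n (expnS _ n.+1) -muln_modr muln_eq0 /= => /eqP ->; rewrite mod0n.
Qed.

Lemma Z2_mul2XI n (x y : Z2) : 2 ^+ n * x = 2 ^+ n * y -> x = y.
Proof.
by elim: n => [|n IHn]; rewrite ?expr0 ?mul1r // exprS -!mulrA => /Z2_mul2I.
Qed.

Lemma Z2_parity (x : Z2) : (exists y, x = 2 * y) \/ (exists y, x = 1 + 2 * y).
Proof.
have [[|[|//]] _ [y ->]] := cong_residue 1 x; rewrite expr1; [left|right].
  by exists y; rewrite add0r.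
by exists y.
Qed.

(** The inverse is the geometric series in -2y, which converges 2-adically. *)
Lemma Z2_odd_unit y : (1 + 2 * y : Z2) \is a GRing.unit.
Proof.
pose z n := \sum_(i < n) (- (2 * y)) ^+ i.
have [n|l lE] := @cong_lim z.
  by exists ((- y) ^+ n); rewrite /z big_ord_recr /= -mulrN exprMn.
apply/(@unitrPr Z2); exists l; apply: cong_eq => n.
apply: cong_trans (congM (cong_refl n (1 + 2 * y)) (lE n)) _.
have := subrX1 (- (2 * y)) n; rewrite -/(z n) => /(congr1 -%R).
rewrite opprB -mulNr opprB opprK => <-.
by exists (- (- y) ^+ n); rewrite -mulrN exprMn; ring.
Qed.

Lemma Z2_even_nunit (y : Z2) : 2 * y \isn't a GRing.unit.
Proof.
apply/negP=> /(@unitrPr Z2) [z /(congr1 (fun x : Z2 => x 0%N)) /eqP].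
by rewrite !Z2_levelM (Z2_level_nat _ 2) pchar_Zp // !mul0r eq_sym oner_eq0.
Qed.

Lemma unit_cong n x y : cong n.+1 x y -> y \is a GRing.unit ->
  x \is a GRing.unit.
Proof.
move=> [z ->] yU; case: (Z2_parity y) => -[w yw].
  by move: yU; rewrite yw (negPf (Z2_even_nunit _)).
rewrite yw exprS -addrA -mulrA -mulrDr; exact: Z2_odd_unit.
Qed.

Lemma Z2_unit_odd (x : Z2) : x \is a GRing.unit -> exists y, x = 1 + 2 * y.
Proof.
by case: (Z2_parity x) => // -[y ->]; rewrite (negPf (Z2_even_nunit _)).
Qed.

(** First-order binomial expansion: the exponent K + 1 is positive, so the higher terms are
    divisible by 2^(K+2). *)
Lemma exp1D2X K (a : Z2) m : exists b : Z2,
  (1 + 2 ^+ K.+1 * a) ^+ m = 1 + 2 ^+ K.+1 * (m%:R * a + 2 * b).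
Proof.
elim: m => [|m [b IHm]]; first by exists 0; rewrite expr0; ring.
exists (b + 2 ^+ K * a * (m%:R * a + 2 * b)).
by rewrite exprS IHm -natr1 exprS; ring.
Qed.

(** Starting from 5 - 1 = 4, each squaring raises the valuation of 5^(2^k) - 1 by exactly one. *)
Lemma exp5_2X k : exists y : Z2, 5 ^+ (2 ^ k) = 1 + 2 ^+ k.+2 * (1 + 2 * y).
Proof.
elim: k => [|k [y IHk]]; first by exists 0; ring.
exists (y + 2 ^+ k * (1 + 2 * y) ^+ 2).
by rewrite expnSr exprM IHk !exprS expr0; ring.
Qed.

Lemma odd_natr m : odd m -> exists r : Z2, m%:R = 1 + 2 * r.
Proof.
move=> m_odd; exists m./2%:R.
by rewrite -[m in LHS]odd_double_half m_odd -mul2n natrD natrM.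
Qed.

(** An odd exponent keeps the valuation, so that of 5^d - 1 is v_2(d) + 2. *)
Lemma exp5_odd k m : odd m ->
  exists y : Z2, 5 ^+ (2 ^ k * m) = 1 + 2 ^+ k.+2 * (1 + 2 * y).
Proof.
move=> /odd_natr[r mE]; have [y yE] := exp5_2X k.
rewrite exprM yE; have [b ->] := exp1D2X k.+1 (1 + 2 * y) m.
by exists (y + r + 2 * y * r + b); rewrite mE; ring.
Qed.

Lemma Z2_odd_neven (x y : Z2) : 1 + 2 * x <> 2 * y.
Proof. by move=> xy; have := Z2_odd_unit x; rewrite xy; apply/negP/Z2_even_nunit. Qed.

Lemma exp5_unit n : (5 ^+ n : Z2) \is a GRing.unit.
Proof.
apply: unitrX; have -> : 5 = 1 + 2 * 2 :> Z2 by ring.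
exact: Z2_odd_unit.
Qed.

Lemma nat_pow2_odd d : (0 < d)%N -> exists k m, odd m /\ d = (2 ^ k * m)%N.
Proof.
move=> d0; exists (logn 2 d), (d`_2^')%N; split.
  by rewrite odd_2'nat part_pnat.
by rewrite -p_part partnC.
Qed.

(** With [exp5_surj], this makes 5 a topological generator of 1 + 4 Z_2, with exponents modulo 2^e
    matching residues modulo 2^(e+2). *)
Lemma exp5_inj e n n' : cong e.+2 (5 ^+ n) (5 ^+ n') -> n = n' %[mod 2 ^ e].
Proof.
wlog nn' : n n' / (n <= n')%N => [wl nE|].
  have [/wl->//|/ltnW/wl -> //] := leqP n n'; exact: cong_sym.
rewrite -(subnKC nn'); move: (n' - n)%N => d [z].
rewrite exprD; have [-> _|/nat_pow2_odd[k [m [m_odd dE]]]] := posnP d.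
  by rewrite addn0.
rewrite [in 5 ^+ d]dE; have [y ->] := exp5_odd k m_odd => zE.
suff ek : (e <= k)%N.
  have /eqP d0 : (2 ^ e %| d)%N by rewrite dE dvdn_mulr // dvdn_exp2l.
  by rewrite -(modnDmr n d) d0 addn0.
(* If k < e, the congruence makes 5^d - 1 equal to 2^(k+2) times the even number 2w, whereas its
   cofactor 1 + 2y is odd. *)
rewrite leqNgt; apply/negP => /subnK ek.
have uE := exp5_unit n; set u : Z2 := 5 ^+ n in uE zE.
pose w := 2 ^+ (e - k.+1) * (- z / u).
suff : 2 ^+ k.+2 * (1 + 2 * y) = 2 ^+ k.+2 * (2 * w).
  by move=> /Z2_mul2XI/Z2_odd_neven.
have e2E : 2 ^+ e.+2 = 2 ^+ k.+2 * (2 * 2 ^+ (e - k.+1)) :> Z2.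
  by rewrite mulrCA mulrA -!exprS -exprD; congr (_ ^+ _); lia.
apply: (mulrI uE); rewrite /w.
have -> : u * (2 ^+ k.+2 * (2 * (2 ^+ (e - k.+1) * (- z / u)))) =
  - (2 ^+ e.+2 * z) * (u / u) by rewrite e2E; ring.
rewrite divrr // mulr1; apply/eqP; rewrite -addr_eq0; apply/eqP.
have -> : 0 = u - u by rewrite subrr.
rewrite {2}zE; ring.
Qed.

Lemma exp5_surj x e : exists n, cong e.+2 (1 + 4 * x) (5 ^+ n).
Proof.
elim: e => [|e [n [y yE]]]; first by exists 0%N, x; rewrite expr0; ring.
have [[w wE]|[w wE]] := Z2_parity y.
  by exists n, w; rewrite yE wE !exprS; ring.
have [r rE] := Z2_unit_odd (exp5_unit n).
have [v vE] := exp5_2X e.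
(* The quotient y is odd here. Multiplying 5^n by 5^(2^e) adds an odd multiple of 2^(e+2), which
   makes the new quotient even. *)
exists (n + 2 ^ e)%N, (w - r - v - 2 * r * v).
by rewrite yE wE exprD vE !exprS rE; ring.
Qed.

(** * Uniformly continuous cochains *)

Lemma residue_cong n x y : residue x n = residue y n -> cong n.+1 x y.
Proof. by move=> xy; apply/cong_level/val_inj. Qed.

Definition eqv n k (g h : 'I_k -> G1) := forall i, cong n (val (g i)) (val (h i)).

(** Uniform continuity, which is continuity by compactness; its closure under sums, products and
    substitutions follows from direct estimates. *)
Definition ucont k (f : ('I_k -> G1) -> Z2) :=
  forall m, exists n, forall g h, eqv n g h -> cong m (f g) (f h).

Lemma eqv_trans n k (h g l : 'I_k -> G1) : eqv n g h -> eqv n h l -> eqv n g l.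
Proof. by move=> gh hl i; apply: cong_trans (gh i) (hl i). Qed.

Lemma eqv_sym n k (g h : 'I_k -> G1) : eqv n g h -> eqv n h g.
Proof. by move=> gh i; apply: cong_sym. Qed.

Lemma eqv_weaken m n k (g h : 'I_k -> G1) : (m <= n)%N -> eqv n g h -> eqv m g h.
Proof. by move=> mn gh i; apply: cong_weaken (gh i). Qed.

Lemma G1_lim k (u : nat -> 'I_k -> G1) : (forall n, eqv n (u n.+1) (u n)) ->
  exists l, forall n, eqv n l (u n).
Proof.
move=> uE.
have /choice[l lE] i : exists l : Z2, forall n, cong n l (val (u n i)).
  by apply: cong_lim => n; apply: uE.
have lU i : l i \is a GRing.unit by apply: unit_cong (lE i 1%N) (valP (u 1%N i)).
by exists (fun i => MkG1 (lU i)) => n i; apply: lE.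
Qed.

(* Compactness of G1^k, by bisection. *)
Lemma ucont_of_continuous k (f : ('I_k -> G1) -> Z2) :
  (forall l m, exists n, forall h, eqv n h l -> cong m (f h) (f l)) -> ucont f.
Proof.
move=> cf m; apply: contrapT => nuf.
(* Uniform continuity modulo 2^m on the ball of [g]. If it fails on a ball, it fails on one of the
   finitely many subballs, indexed by the residues [rho]. *)
pose good n g := exists N, forall h h', eqv n h g -> eqv N h h' ->
  cong m (f h) (f h').
have step (ng : nat * ('I_k -> G1)) : exists g', ~ good ng.1 ng.2 ->
    eqv ng.1 g' ng.2 /\ ~ good ng.1.+1 g'.
  case: ng => n g /=; apply: contrapT => noext.
  have ngood : ~ good n g by move=> gd; apply: noext; exists g.
  have ext g' : eqv n g' g -> good n.+1 g'.
    move=> gg'; apply: contrapT => ngood'; apply: noext.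
    by exists g' => _; split.
  pose rho (h : 'I_k -> G1) := [ffun i => Ordinal (ltn_residue (val (h i)) n)].
  have /choice[N NE] c : exists N, forall h h', rho h = c -> eqv n h g ->
      eqv N h h' -> cong m (f h) (f h').
    have [[g0 [g0g <-]]|noc] := pselect (exists g0, eqv n g0 g /\ rho g0 = c).
      have [N NE] := ext g0 g0g; exists N => h h' hg0 _.
      apply: NE => i; apply: residue_cong.
      have /(congr1 val) := congr1 (fun r : {ffun _} => r i) hg0.
      by rewrite !ffunE.
    by exists 0%N => h h' hc hg; case: noc; exists h.
  apply: ngood; exists (\max_c N c)%N => h h' hg hh'.
  apply: (NE (rho h) h h' erefl hg); apply: eqv_weaken hh'.
  exact: leq_bigmax.
have /choice[s sE] := step.
pose u := fix u n := if n is n'.+1 then s (n', u n') else fun _ => 1%g.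
have ugood n : ~ good n (u n).
  elim: n => [[N NE]|n IHn]; last by have [] := sE (n, u n) IHn.
  by apply: nuf; exists N => g h; apply: NE => i; exact: cong0.
have [n|l lE] := @G1_lim k u; first by have [] := sE (n, u n) (ugood n).
have [n nE] := cf l m; apply: (ugood n); exists n => h h' hu hh'.
have hl : eqv n h l by apply: eqv_trans hu (eqv_sym (lE n)).
apply: cong_trans (nE _ hl) (cong_sym (nE _ _)).
exact: eqv_trans (eqv_sym hh') hl.
Qed.

Section UcontOps.
Variable k : nat.
Implicit Types f g : ('I_k -> G1) -> Z2.

Lemma ucont_cst c : ucont (fun _ : 'I_k -> G1 => c).
Proof. by move=> m; exists 0%N => *; apply: cong_refl. Qed.

Lemma ucont2 (op : Z2 -> Z2 -> Z2) f g :
  (forall n x y x' y', cong n x y -> cong n x' y' -> cong n (op x x') (op y y')) ->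
  ucont f -> ucont g -> ucont (fun x => op (f x) (g x)).
Proof.
move=> opE uf ug m; have [n nE] := uf m; have [n' n'E] := ug m.
exists (maxn n n') => x y xy; apply: opE.
  exact: nE (eqv_weaken (leq_maxl n n') xy).
exact: n'E (eqv_weaken (leq_maxr n n') xy).
Qed.

Lemma ucontD f g : ucont f -> ucont g -> ucont (fun x => f x + g x).
Proof. by apply: (@ucont2 (fun x y => x + y)) => *; apply: congD. Qed.

Lemma ucontB f g : ucont f -> ucont g -> ucont (fun x => f x - g x).
Proof. by apply: (@ucont2 (fun x y => x - y)) => *; apply: congB. Qed.

Lemma ucontM f g : ucont f -> ucont g -> ucont (fun x => f x * g x).
Proof. by apply: (@ucont2 (fun x y => x * y)) => *; apply: congM. Qed.

Lemma ucontZ c f : ucont f -> ucont (fun x => c * f x).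
Proof. by apply: ucontM; apply: ucont_cst. Qed.

Lemma ucont_sum (I : Type) (r : seq I) (F : I -> ('I_k -> G1) -> Z2) :
  (forall i, ucont (F i)) -> ucont (fun x => \sum_(i <- r) F i x).
Proof.
move=> uF; elim: r => [|i r IHr].
  by under eq_fun do rewrite big_nil; apply: ucont_cst.
by under eq_fun do rewrite big_cons; apply: ucontD.
Qed.

Lemma ucont_comp k' (a : ('I_k' -> G1) -> 'I_k -> G1) f :
  (forall n x y, eqv n x y -> eqv n (a x) (a y)) ->
  ucont f -> ucont (fun x => f (a x)).
Proof.
by move=> aE uf m; have [n nE] := uf m; exists n => g h gh; apply/nE/aE.
Qed.

End UcontOps.

Lemma cong_inv n (x y : Z2) : x \is a GRing.unit -> y \is a GRing.unit ->
  cong n x y -> cong n x^-1 y^-1.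
Proof.
move=> xU yU [z xE]; exists (- (x^-1 * y^-1 * z)).
have -> : 2 ^+ n * (- (x^-1 * y^-1 * z)) = x^-1 * y^-1 * (y - x).
  by rewrite xE; ring.
by rewrite mulrBr -mulrA mulVr // mulr1 mulrAC mulVr // mul1r addrC subrK.
Qed.

Lemma cong_exprz n (x y : Z2) (j : int) : x \is a GRing.unit ->
  y \is a GRing.unit -> cong n x y -> cong n (x ^ j) (y ^ j).
Proof.
case: j => j xU yU xy; first exact: congX.
by rewrite NegzE -!exprz_inv; apply/congX/cong_inv.
Qed.

Lemma ucont_char k (i : 'I_k) (j : int) : ucont (fun g => val (g i) ^ j).
Proof.
move=> m; exists m => g h gh; apply: cong_exprz (gh i).
  exact: (valP (g i)).
exact: (valP (h i)).
Qed.

(** * Topological continuity in terms of congruences *)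

Local Open Scope classical_set_scope.

Lemma nbhs_G1 (x : G1) n : nbhs x [set y : G1 | cong n (val y) (val x)].
Proof.
have xn := @G1val_continuous x _ (adic2_nbhs_ball (val x) n).
apply: (@filterS _ (nbhs x) _ _ _ _ xn) => y /= [z _ zE].
by exists z; rewrite -zE -exp2rE mulr_natl.
Qed.

Lemma nbhs_G1P (x : G1) (A : set G1) : nbhs x A ->
  exists n, forall y : G1, cong n (val y) (val x) -> A y.
Proof.
rewrite nbhsE => -[B [[C oC CB] Bx] BA].
have [n nC] : nbhs (val x) C.
  by apply: open_nbhs_nbhs; split=> //; move: Bx; rewrite -CB.
exists n => y [z zE]; apply: BA; rewrite -CB /= zE -exp2rE mulr_natl.
exact: nC.
Qed.

(** The filter generated by the balls converges to [l] in each coordinate, hence in the product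
    topology. *)
Lemma nbhs_ptwsP k (l : {ptws 'I_k -> G1}) (A : set {ptws 'I_k -> G1}) :
  nbhs l A -> exists n, forall h, eqv n h l -> A h.
Proof.
pose F := filter_from setT (fun n => [set h : {ptws 'I_k -> G1} | eqv n h l]).
have FF : Filter F.
  apply: filter_from_filter; first by exists 0%N.
  move=> m n _ _; exists (maxn m n) => // h hl; split; apply: eqv_weaken hl.
    exact: leq_maxl.
  exact: leq_maxr.
have : F --> l.
  apply/cvg_sup => i B; rewrite nbhsE => -[_ [[C oC <-] /= Cl] CB].
  have [n nC] : exists n, forall y : G1, cong n (val y) (val (l i)) -> C y.
    by apply: nbhs_G1P; apply: open_nbhs_nbhs.
  by exists n => // h hl; apply/CB/nC/hl.
by move=> Fl /Fl[n _ nA]; exists n.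
Qed.

(** A ball constrains every coordinate, and there are finitely many of them. *)
Lemma nbhs_ptws k (l : {ptws 'I_k -> G1}) n :
  nbhs l [set h : {ptws 'I_k -> G1} | eqv n h l].
Proof.
have h i : nbhs l [set h : {ptws 'I_k -> G1} | cong n (val (h i)) (val (l i))].
  exact: (@proj_continuous _ (fun _ : 'I_k => G1) i l _ (nbhs_G1 (l i) n)).
exact: (@filter_forall _ _
  (fun i (h : {ptws 'I_k -> G1}) => cong n (val (h i)) (val (l i))) (nbhs l)).
Qed.

Lemma coefD t (x y : E t) : coef (x + y) = coef x + coef y.
Proof. by []. Qed.

Lemma coefMn t (x : E t) n : coef (x *+ n) = coef x *+ n.
Proof. by elim: n => [|n IHn] //; rewrite !mulrS coefD IHn. Qed.

Section EvenDegree.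
Variables (t : int) (t_even : (2 %| t)%Z).

Fact coef_even_subproof (a : Z2) : (a : Z2^o) \in in_degree t.
Proof. by rewrite inE t_even. Qed.

Definition ofcoef (a : Z2) : E t := MkE (coef_even_subproof a).

(** For even [t] the subgroup 2^m E_t consists of all elements with coefficient in 2^m Z_2, so the
    topology of [E t] is read on coefficients. *)
Lemma continuous_ucont k (f : {ptws 'I_k -> G1} -> E t) :
  continuous f <-> ucont (fun g => coef (f g)).
Proof.
split=> [cf|uf].
  apply: ucont_of_continuous => l m.
  have fA : nbhs (f l) [set y | cong m (coef y) (coef (f l))].
    exists m => y; exists (coef y).
    by rewrite coefD coefMn -exp2rE mulr_natl.
  have [n nA] := nbhs_ptwsP (cf l _ fA).
  by exists n.
move=> l A [m mA]; have [n nE] := uf m.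
apply: (@filterS _ (nbhs l) _ _ _ _ (nbhs_ptws l n)) => h /nE[z zE] /=.
suff -> : f h = f l + ofcoef z *+ 2 ^ m by [].
apply: val_inj; rewrite -[LHS]/(coef (f h)) zE -exp2rE mulr_natl.
by rewrite -[RHS]/(coef _) coefD coefMn.
Qed.
End EvenDegree.

(** * The bar differential on coinduced cochains *)

Definition gcons k (h : G1) (g : 'I_k -> G1) : 'I_k.+1 -> G1 :=
  fun i => if unlift ord0 i is Some i' then g i' else h.

Definition gtail k (g : 'I_k.+1 -> G1) : 'I_k -> G1 := fun i => g (lift ord0 i).

Definition ginit k (g : 'I_k.+1 -> G1) : 'I_k -> G1 :=
  fun i => g (widen_ord (leqnSn k) i).

Lemma gcons0 k h (g : 'I_k -> G1) : gcons h g ord0 = h.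
Proof. by rewrite /gcons unlift_none. Qed.

Lemma gconsS k h (g : 'I_k -> G1) i : gcons h g (lift ord0 i) = g i.
Proof. by rewrite /gcons liftK. Qed.

Lemma gtuple_ext k (g h : 'I_k.+1 -> G1) :
  g ord0 = h ord0 -> gtail g = gtail h -> g = h.
Proof.
move=> gh0 gh; apply/funext => i; case: (unliftP ord0 i) => [i' ->|-> //].
exact: (congr1 (@^~ i') gh).
Qed.

Lemma gtail_cons k h (g : 'I_k -> G1) : gtail (gcons h g) = g.
Proof. by apply/funext => i; apply: gconsS. Qed.

Lemma gcons_eta k (g : 'I_k.+1 -> G1) : gcons (g ord0) (gtail g) = g.
Proof. by apply: gtuple_ext; rewrite ?gcons0 ?gtail_cons. Qed.

Lemma widen_lift k (i : 'I_k) : widen_ord (leqnSn k.+1) (lift ord0 i) =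
  lift ord0 (widen_ord (leqnSn k) i).
Proof. exact: val_inj. Qed.

Lemma widen_ord00 k : widen_ord (leqnSn k.+1) ord0 = ord0.
Proof. exact: val_inj. Qed.

Lemma ginit_cons k h (g : 'I_k.+1 -> G1) :
  ginit (gcons h g) = gcons h (ginit g).
Proof.
apply: gtuple_ext; first by rewrite /ginit widen_ord00 !gcons0.
by apply/funext => i; rewrite /gtail /ginit widen_lift !gconsS.
Qed.

Lemma merge0 k (g : 'I_k.+2 -> G1) :
  Defs.merge ord0 g = gcons (g ord0 * g (lift ord0 ord0))%g (gtail (gtail g)).
Proof.
by apply: gtuple_ext; rewrite ?gtail_cons ?gcons0 // /Defs.merge /= widen_ord00.
Qed.

Lemma mergeS k i (g : 'I_k.+2 -> G1) :
  Defs.merge (lift ord0 i) g = gcons (g ord0) (Defs.merge i (gtail g)).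
Proof.
apply: gtuple_ext; rewrite ?gtail_cons ?gcons0; first by rewrite /Defs.merge /= widen_ord00.
apply/funext => i'; rewrite /gtail /Defs.merge widen_lift /= !/bump /= !add1n ltnS.
by rewrite (inj_eq (@lift_inj _ ord0)).
Qed.

Lemma gtail_init k (g : 'I_k.+2 -> G1) : gtail (ginit g) = ginit (gtail g).
Proof. by apply/funext => i; rewrite /gtail /ginit widen_lift. Qed.

Definition gmul k h (g : 'I_k.+1 -> G1) := gcons (h * g ord0)%g (gtail g).

Lemma gmul_cons k h h' (g : 'I_k -> G1) :
  gmul h (gcons h' g) = gcons (h * h')%g g.
Proof. by rewrite /gmul gcons0 gtail_cons. Qed.

Lemma gmulM k h h' (g : 'I_k.+1 -> G1) : gmul (h * h')%g g = gmul h (gmul h' g).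
Proof. by rewrite /gmul gcons0 gtail_cons mulgA. Qed.

Lemma gmul1 k (g : 'I_k.+1 -> G1) : gmul 1%g g = g.
Proof. by apply: gtuple_ext; rewrite /gmul ?gcons0 ?gtail_cons ?mul1g. Qed.

Lemma merge_gmul k (i : 'I_k.+1) h (g : 'I_k.+2 -> G1) :
  Defs.merge i (gmul h g) = gmul h (Defs.merge i g).
Proof.
case: (unliftP ord0 i) => [i' ->|->].
  rewrite !mergeS /gmul gcons0 !gtail_cons gcons0. reflexivity.
by rewrite !merge0 /gmul !gcons0 !gtail_cons gconsS mulgA.
Qed.

Lemma ginit_gmul k h (g : 'I_k.+2 -> G1) : ginit (gmul h g) = gmul h (ginit g).
Proof. by rewrite /gmul ginit_cons -gtail_init /ginit widen_ord00. Qed.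

Lemma eqv_gcons n k h h' (g g' : 'I_k -> G1) : cong n (val h) (val h') ->
  eqv n g g' -> eqv n (gcons h g) (gcons h' g').
Proof.
by move=> hh' gg' i; case: (unliftP ord0 i) => [i' ->|->]; rewrite ?gconsS ?gcons0.
Qed.

Lemma eqv_gmul n k h (g g' : 'I_k.+1 -> G1) : eqv n g g' ->
  eqv n (gmul h g) (gmul h g').
Proof.
move=> gg'; apply: eqv_gcons; last by move=> i; apply: gg'.
exact: congM (cong_refl _ _) (gg' ord0).
Qed.

(* Functions F(x; g_1, ..., g_b) are b-cochains with values in the coinduced
   module of functions of x, on which g acts by right translation of x. Hence
   the differential [bar] involves no action on the coefficients. *)
Notation coind b := (('I_b.+1 -> G1) -> Z2).

Definition bar b (F : coind b) : coind b.+1 := fun g =>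
  \sum_(i < b.+1) (-1) ^+ i * F (Defs.merge i g) + (-1) ^+ b.+1 * F (ginit g).

Lemma barB b (F H : coind b) : bar (F - H) = bar F - bar H.
Proof.
apply/funext => g; rewrite /bar !fctE.
under eq_bigr do rewrite mulrBr; rewrite sumrB; ring.
Qed.

Lemma bar_gmul b h (F : coind b) : bar (F \o gmul h) = bar F \o gmul h.
Proof.
apply/funext => g; rewrite /bar /= ginit_gmul; congr (_ + _).
by apply: eq_bigr => i _; rewrite merge_gmul.
Qed.

Lemma barZ b c (F : coind b) : bar (fun g => c * F g) = fun g => c * bar F g.
Proof.
apply/funext => g; rewrite /bar mulrDr mulr_sumr mulrCA; congr (_ + _).
by apply: eq_bigr => i _; rewrite mulrCA.
Qed.

(** Evaluation at x = 1 is a contracting homotopy: the face [merge ord0] gives back F(g), and the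
    other faces cancel. *)
Lemma bar_cons1 b (F : coind b.+1) g :
  bar F (gcons 1%g g) + bar (fun h => F (gcons 1%g h)) g = F g.
Proof.
rewrite {1}/bar big_ord_recl merge0 gcons0 gconsS mul1g expr0 mul1r gtail_cons.
rewrite ginit_cons /bar.
under eq_bigr do rewrite mergeS gcons0 gtail_cons lift0 exprS mulN1r mulNr.
rewrite sumrN (exprS _ b.+1).
rewrite gcons_eta; ring.
Qed.

Lemma bar0_cons1 (F : coind 0) g :
  bar F (gcons 1%g g) = F g - F (fun=> 1%g).
Proof.
rewrite /bar big_ord1 merge0 gcons0 gconsS mul1g expr0 mul1r gtail_cons expr1 mulN1r.
congr (F _ - F _); first by rewrite gcons_eta.
by apply/funext => i; rewrite ord1 /ginit widen_ord00 gcons0.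
Qed.

Lemma bar_cst (c : Z2) : bar (fun _ : 'I_1 -> G1 => c) = 0.
Proof. by apply/funext => g; rewrite /bar big_ord1 expr0 expr1 mul1r mulN1r subrr. Qed.

(* By equivariance it is enough to evaluate at x = 1. *)
Lemma bar_bar_ext b (F : coind b) :
  (forall H g, bar (bar (H : coind b)) (gcons 1%g g) = 0) -> bar (bar F) = 0.
Proof.
move=> bb1; apply/funext => g.
have -> : g = gmul (g ord0) (gcons 1%g (gtail g)).
  by rewrite gmul_cons mulg1 gcons_eta.
by rewrite -[LHS]/((bar (bar F) \o _) _) -!bar_gmul bb1.
Qed.

(** Induction on b with the homotopy s of [bar_cons1], instead of identities between faces: s bar
    bar H = bar H - bar (H - bar s H) = bar bar s H. *)
Lemma bar_bar b (F : coind b) : bar (bar F) = 0.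
Proof.
apply: bar_bar_ext; elim: b {F} => [|b IHb] H g.
  have := bar_cons1 (bar H) g.
  have -> : (fun h => bar H (gcons 1%g h)) = H - cst (H (fun=> 1%g)).
    by apply/funext => h; rewrite bar0_cons1.
  by rewrite barB bar_cst subr0 -[RHS]add0r => /addIr.
pose H' h := H (gcons 1%g h).
have bH' : (fun h => bar H (gcons 1%g h)) = H - bar H'.
  apply/funext => h; apply: (addIr (bar H' h)); rewrite bar_cons1.
  by rewrite -[RHS]/(H h - bar H' h + bar H' h) subrK.
have := bar_cons1 (bar H) g; rewrite bH' barB.
by rewrite (bar_bar_ext _ IHb) subr0 -[RHS]add0r => /addIr.
Qed.

(** * Double complexes with exact rows and columns *)

(* [h] identifies the quotient of the subgroup Z by B with X. *)
Definition presents (A X : zmodType) (Z B : A -> Prop) := exists h : A -> X,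
  [/\ forall z z', Z z -> Z z' -> h (z - z') = h z - h z',
      forall x, exists2 z, Z z & h z = x &
      forall z, Z z -> (h z = 0 <-> B z)].

Section Staircase.
Variables (A : nat -> zmodType) (P : forall a b : nat, A b -> Prop).
Variables (dh : forall a b : nat, A b -> A b) (dv : forall b, A b -> A b.+1).
Arguments P a {b}.
Arguments dh a {b}.
Arguments dv {b}.
Hypotheses (PB : forall a b (x y : A b), P a x -> P a y -> P a (x - y))
  (dhB : forall a b (x y : A b), dh a (x - y) = dh a x - dh a y)
  (dvB : forall b (x y : A b), dv (x - y) = dv x - dv y)
  (dhP : forall a b (x : A b), P a x -> P a.+1 (dh a x))
  (dvP : forall a b (x : A b), P a x -> P a (dv x))
  (dhdv : forall a b (x : A b), dh a (dv x) = dv (dh a x))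
  (dhdh : forall a b (x : A b), P a x -> dh a.+1 (dh a x) = 0)
  (dvdv : forall b (x : A b), dv (dv x) = 0)
  (exact_h : forall a b (x : A b), P a.+1 x -> dh a.+1 x = 0 ->
     exists2 y, P a y & dh a y = x)
  (exact_v : forall a b (x : A b.+1), P a x -> dv x = 0 ->
     exists2 y, P a y & dv y = x).

(** Column [a] and row [b] hold the part of [A b] where [P a] is true. In column 0, [bicocycle]
    modulo [vboundary] is the cohomology of the kernel of [dh]; in row 0, [bicocycle] modulo
    [hboundary] is that of the kernel of [dv]. *)
Definition bicocycle a b (x : A b) := [/\ P a x, dh a x = 0 & dv x = 0].
Definition vboundary a b (x : A b.+1) :=
  exists y : A b, [/\ P a y, dh a y = 0 & dv y = x].
Definition hboundary a b (x : A b) :=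
  exists y : A b, [/\ P a y, dv y = 0 & dh a y = x].

(** If x = dh y with dv y = 0, then y = dv z and x = dv (dh z); the converse is symmetric. *)
Lemma hboundary_vboundary a b (x : A b.+1) : hboundary a x <-> vboundary a.+1 x.
Proof.
split=> [[y [Py yv <-]]|[y [Py yh <-]]].
  have [z Pz zy] := exact_v Py yv; exists (dh a z).
  by rewrite dhdh // -dhdv zy; split=> //; apply: dhP.
have [z Pz zy] := exact_h Py yh; exists (dv z).
by rewrite dvdv dhdv zy; split=> //; apply: dvP.
Qed.

(** The zigzag: a bicocycle z is written dv y and sent to dh y. Another choice of y changes dh y by
    an [hboundary], so a chosen lift induces a well-defined map on classes. *)
Lemma staircase_step a b (X : zmodType) :
  presents X (@bicocycle a.+1 b) (@hboundary a b) ->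
  presents X (@bicocycle a b.+1) (@vboundary a b).
Proof.
case=> h [hB hsurj hker].
have /choice[y yE] (z : A b.+1) :
    exists y, bicocycle a z -> P a y /\ dv y = z.
  have [[Pz _ zv]|nz] := pselect (bicocycle a z); last by exists 0.
  by have [y Py yz] := exact_v Pz zv; exists y.
have dhyZ z u : bicocycle a z -> P a u -> dv u = z -> bicocycle a.+1 (dh a u).
  by move=> [_ zh _] Pu uz; split; [apply: dhP | apply: dhdh | rewrite -dhdv uz].
have hy z u : bicocycle a z -> P a u -> dv u = z -> h (dh a u) = h (dh a (y z)).
  move=> Zz Pu uz; have [Py yz] := yE z Zz.
  apply/eqP; rewrite -subr_eq0; apply/eqP.
  rewrite -hB -?dhB; [|exact: (dhyZ _ _ _ Zz Pu uz)|
    exact: (dhyZ _ _ _ Zz Py yz)].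
  apply/hker; first rewrite dhB; last first.
    by exists (u - y z); rewrite dvB uz yz subrr; split=> //; apply: PB.
  have [Pu' uh uv] := dhyZ _ _ _ Zz Pu uz.
  have [Py' yh yv] := dhyZ _ _ _ Zz Py yz.
  by split; [apply: PB | rewrite dhB uh yh subrr | rewrite dvB uv yv subrr].
exists (fun z => h (dh a (y z))); split.
- move=> z z' Zz Zz'; have [Py yz] := yE z Zz; have [Py' yz'] := yE z' Zz'.
  rewrite -hB -?dhB; [|exact: (dhyZ _ _ _ Zz Py yz)|
    exact: (dhyZ _ _ _ Zz' Py' yz')].
  apply/esym/hy; [|exact: PB|by rewrite dvB yz yz'].
  case: Zz Zz' => Pz zh zv [Pz' zh' zv'].
  by split; [apply: PB | rewrite dhB zh zh' subrr | rewrite dvB zv zv' subrr].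
- move=> x; have [w [Pw wh wv] <-] := hsurj x.
  have [u Pu uw] := exact_h Pw wh.
  have Zu : bicocycle a (dv u).
    by split; [apply: dvP | rewrite dhdv uw | rewrite dvdv].
  by exists (dv u) => //; rewrite -uw; apply/esym/hy.
move=> z Zz; have [Py yz] := yE z Zz; split.
  move=> /hker []; first exact: (dhyZ _ _ _ Zz Py yz).
  move=> u [Pu uv uh]; exists (y z - u).
  by rewrite dhB uh subrr dvB uv subr0; split=> //; apply: PB.
move=> [u [Pu uh uz]]; rewrite -(hy z u) // uh.
have Z0 : bicocycle a.+1 (0 : A b).
  rewrite -uh; exact: (dhyZ _ _ _ Zz Pu uz).
by have := hB 0 0 Z0 Z0; rewrite !subrr.
Qed.

(** Iterated zigzags along an antidiagonal; [hboundary_vboundary] converts the boundaries between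
    consecutive steps. *)
Lemma staircase b a (X : zmodType) :
  presents X (@bicocycle (a + b).+1 0) (@hboundary (a + b) 0) ->
  presents X (@bicocycle a b.+1) (@vboundary a b).
Proof.
elim: b a => [|b IHb] a; first by rewrite addn0; apply: staircase_step.
rewrite -addSnnS => /IHb[h [hB hsurj hker]].
apply: staircase_step; exists h; split=> // z Zz.
by rewrite hboundary_vboundary; apply: hker.
Qed.
End Staircase.

(** * Integration along the orbits of 5 *)

Lemma G1mulC (g h : G1) : (g * h)%g = (h * g)%g.
Proof. by apply: val_inj; apply: mulrC. Qed.

Lemma valG1M (g h : G1) : val (g * h)%g = val g * val h. Proof. by []. Qed.

Lemma valG1X (g : G1) n : val (g ^+ n)%g = val g ^+ n.
Proof. by elim: n => [|n IHn] //; rewrite expgS exprS valG1M IHn. Qed.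

Fact negone_subproof : (-1 : Z2) \is a GRing.unit.
Proof. by rewrite unitrN unitr1. Qed.
Definition negone : G1 := MkG1 negone_subproof.

Definition five : G1 := MkG1 (exp5_unit 1).

Lemma val_five : val five = 5. Proof. by rewrite /= expr1. Qed.

Lemma negoneK : (negone * negone = 1)%g.
Proof. by apply: val_inj; rewrite /= mulrNN mulr1. Qed.

Definition pos4 (g : G1) : bool := `[< cong 2 (val g) 1 >].

Lemma pos4P (g : G1) : reflect (exists y, val g = 1 + 4 * y) (pos4 g).
Proof.
apply: (iffP (asboolP _)) => -[y yE]; exists y; rewrite yE; ring.
Qed.

Lemma pos4_neg (g : G1) : pos4 (negone * g)%g = ~~ pos4 g.
Proof.
have [y yE] := Z2_unit_odd (valP g); have [[z zE]|[z zE]] := Z2_parity y.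
  have -> : pos4 g by apply/pos4P; exists z; rewrite yE zE; ring.
  apply/negbTE/negP => /pos4P[w]; rewrite valG1M yE zE /= => wE.
  suff : (1 + 2 * z : Z2) = 2 * (- w) by apply: Z2_odd_neven.
  apply: Z2_mul2I.
  have -> : 2 * (1 + 2 * z) = 1 - -1 * (1 + 2 * (2 * z)) by ring.
  by rewrite wE; ring.
have -> : pos4 (negone * g)%g.
  by apply/pos4P; exists (- 1 - z); rewrite valG1M yE zE /=; ring.
apply/esym/negP => /pos4P[w]; rewrite yE zE => wE.
suff : (1 + 2 * z : Z2) = 2 * w by apply: Z2_odd_neven.
by apply: Z2_mul2I; apply: (addrI 1); rewrite wE; ring.
Qed.

Lemma pos4_cong n g h : cong n.+2 (val g) (val h) -> pos4 g = pos4 h.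
Proof.
move=> /(@cong_weaken 2 n.+2 _ _ isT) gh; apply/asboolP/asboolP.
  by apply: cong_trans; apply: cong_sym.
exact: cong_trans.
Qed.

Lemma pos4_five g : pos4 (five * g)%g = pos4 g.
Proof.
by apply: (@pos4_cong 0); exists (val g); rewrite valG1M val_five; ring.
Qed.

(** The component of [g] in {1, -1} under the splitting of the units as {1, -1} x (1 + 4 Z_2). *)
Definition sgn (g : G1) : G1 := if pos4 g then 1%g else negone.

Lemma sgnK g : (sgn g * sgn g = 1)%g.
Proof. by rewrite /sgn; case: ifP; rewrite ?mul1g ?negoneK. Qed.

Lemma exp5_sgn (g : G1) e : exists n, cong e.+2 (val (g * sgn g)%g) (5 ^+ n).
Proof.
suff [y ->] : exists y, val (g * sgn g)%g = 1 + 4 * y by apply: exp5_surj.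
rewrite /sgn; case: ifP => [/pos4P[y yE]|/negbT].
  by exists y; rewrite mulg1.
by rewrite -pos4_neg G1mulC => /pos4P.
Qed.

Section PeriodicSums.
Variables (m p : nat) (f : nat -> Z2).
Hypothesis fp : forall i, cong m (f (i + p)) (f i).
Let S n := \sum_(i < n) f i.

Lemma periodic_sumD n : cong m (S (n + p)) (S n + S p).
Proof.
elim: n => [|n IHn]; first by rewrite add0n /S big_ord0 add0r; apply: cong_refl.
rewrite addSn /S !big_ord_recr /= -/(S _) -/(S _).
have -> : S n + f n + S p = S n + S p + f n by ring.
exact: congD IHn (fp n).
Qed.

Lemma periodic_sumM n c : cong m (S (n + c * p)) (S n + c%:R * S p).
Proof.
elim: c => [|c IHc].
  by rewrite mul0n addn0 mul0r addr0; apply: cong_refl.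
rewrite mulSn addnCA addnC; apply: cong_trans (periodic_sumD _) _.
have -> : S n + c.+1%:R * S p = S n + c%:R * S p + S p by rewrite -natr1; ring.
exact: congD IHc (cong_refl _ _).
Qed.

(** The sum over 2^m periods is 2^m times the sum over one period, hence 0 modulo 2^m. *)
Lemma periodic_sum_mod n n' : n = n' %[mod 2 ^ m * p] -> cong m (S n) (S n').
Proof.
have red k : cong m (S k) (S (k %% (2 ^ m * p))).
  rewrite {1}(divn_eq k (2 ^ m * p)) addnC mulnA.
  apply: cong_trans (periodic_sumM _ _) _.
  exists ((k %/ (2 ^ m * p))%:R * S p); rewrite natrM exp2rE; ring.
move=> nn'; apply: cong_trans (red n) _; rewrite nn'.
exact: cong_sym.
Qed.
End PeriodicSums.

Lemma cong_exp5_period e i : cong e (5 ^+ (i + 2 ^ e)) (5 ^+ i).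
Proof.
have [y yE] := exp5_2X e; exists (5 ^+ i * 4 * (1 + 2 * y)).
by rewrite exprD yE !exprS; ring.
Qed.

(* Discrete integration along the orbits of 5: the value at (+-5^n, t) is the
   sum of q over (+-5^i, t) for i < n. Modulo 2^m the summand has some period
   2^N in i, hence the sum has period 2^(N+m) in n and extends by continuity. *)
Lemma five_primitive k (q : coind k) : ucont q ->
  exists psi : coind k, ucont psi /\ forall g, psi (gmul five g) - psi g = q g.
Proof.
(* The bound N(m) + m is summed over all smaller indices so that [e] is nondecreasing: an exponent
   valid for m + 1 is then valid for m. *)
move=> /choice[N NE]; pose e m := (\sum_(i < m.+1) (N i + i))%N.
have eS m : (e m <= e m.+1)%N by rewrite /e [in X in (_ <= X)%N]big_ord_recr leq_addr.
have Ne m : (N m + m <= e m)%N by rewrite /e big_ord_recr /= leq_addl.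
pose base (g : 'I_k.+1 -> G1) := gcons (sgn (g ord0)) (gtail g).
pose S g n := \sum_(i < n) q (gmul (five ^+ i)%g (base g)).
pose isexp m (g : 'I_k.+1 -> G1) n :=
  cong (e m).+2 (val (g ord0 * sgn (g ord0))%g) (5 ^+ n).
have S_mod m g n n' : n = n' %[mod 2 ^ e m] -> cong m (S g n) (S g n').
  move=> nn'; apply: (@periodic_sum_mod m (2 ^ N m)
    (fun i => q (gmul (five ^+ i)%g (base g)))) => [i|].
    apply: NE; rewrite /gmul; apply: eqv_gcons (fun i => cong_refl _ _).
    rewrite !valG1M !valG1X val_five; apply: congM (cong_refl _ _).
    exact: cong_exp5_period.
  rewrite -expnD addnC; apply/eqP.
  have d : (2 ^ (N m + m) %| 2 ^ e m)%N by rewrite dvdn_exp2l.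
  by rewrite -(modn_dvdm n d) nn' modn_dvdm.
have isexp_S m g n n' : isexp m g n -> isexp m g n' -> cong m (S g n) (S g n').
  move=> gn gn'; apply: S_mod; apply: exp5_inj.
  exact: cong_trans (cong_sym gn) gn'.
(* The value at [g] is the limit of the partial sums up to exponents n(m) with 5^n(m) close to
   [g ord0] up to sign. *)
have /choice[psi psiE] g : exists l, forall m n, isexp m g n -> cong m l (S g n).
  have /choice[n nE] m : exists n, isexp m g n by apply: exp5_sgn.
  have [m|l lE] := @cong_lim (fun m => S g (n m)).
    by apply: isexp_S (nE m); apply: cong_weaken (nE m.+1); rewrite !ltnS.
  by exists l => m n' n'E; apply: cong_trans (lE m) (isexp_S _ _ _ _ (nE m) n'E).
exists psi; split=> [m|g].
  exists (e m).+2 => g h gh; have [n gn] := exp5_sgn (g ord0) (e m).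
  have sgh : sgn (g ord0) = sgn (h ord0) by rewrite /sgn (pos4_cong (gh ord0)).
  have hn : isexp m h n.
    apply: cong_trans gn; rewrite sgh !valG1M; apply: congM (cong_refl _ _).
    exact: cong_sym (gh ord0).
  apply: cong_trans (psiE g m n gn) (cong_trans _ (cong_sym (psiE h m n hn))).
  apply: cong_sum => i; apply: NE; apply: eqv_gmul.
  rewrite /base sgh; apply: eqv_gcons; first exact: cong_refl.
  move=> i'; apply: cong_weaken (gh _); apply: leq_trans (leqW (leqW (Ne m))).
  exact: leq_addr.
apply: cong_eq => m; have [n gn] := exp5_sgn (g ord0) (e m).
have base5 : base (gmul five g) = base g.
  by rewrite /base /gmul gcons0 gtail_cons /sgn pos4_five.
(* Multiplication by 5 raises the exponent by one and keeps the base point, so the difference is the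
   last summand, taken at a point close to [g]. *)
have g5n : isexp m (gmul five g) n.+1.
  rewrite /isexp /gmul gcons0 /sgn pos4_five -/(sgn _) -mulgA valG1M val_five exprS.
  exact: congM (cong_refl _ _) gn.
apply: cong_trans (congB (psiE _ m _ g5n) (psiE _ m _ gn)) _.
rewrite /S base5 big_ord_recr /= addrAC subrr add0r.
apply: NE; rewrite gmul_cons -[X in eqv _ _ X]gcons_eta.
apply: eqv_gcons (fun i => cong_refl _ _).
have le : (N m <= (e m).+2)%N.
  by apply: leq_trans (leqW (leqW (Ne m))); apply: leq_addr.
apply: cong_sym; apply: cong_weaken le _.
have := congM gn (cong_refl (e m).+2 (val (sgn (g ord0)))).
by rewrite -valG1M -mulgA sgnK mulg1 valG1M valG1X val_five.
Qed.

(** The subgroup generated by 5 and -1 is dense, and [psi] is continuous. *)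
Lemma five_neg_invariant k (psi : coind k) : ucont psi ->
  (forall g, psi (gmul five g) = psi g) ->
  (forall g, psi (gmul negone g) = psi g) ->
  forall g, psi g = psi (gcons 1%g (gtail g)).
Proof.
move=> upsi inv5 invN g; apply: cong_eq => m; have [n nE] := upsi m.
have inv5X i h : psi (gmul (five ^+ i)%g h) = psi h.
  by elim: i h => [|i IHi] h; rewrite ?gmul1 // expgS gmulM inv5 IHi.
have invsgn h : psi (gmul (sgn (g ord0)) h) = psi h.
  by rewrite /sgn; case: ifP; rewrite ?gmul1.
rewrite -(invsgn g) -(inv5X (projT1 (cid (exp5_sgn (g ord0) n))) (gcons _ _)).
case: cid => /= i iE; apply: nE; rewrite gmul_cons mulg1.
apply: eqv_gcons (fun i => cong_refl _ _).
rewrite valG1X val_five G1mulC; apply: cong_weaken iE.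
by rewrite !leqW.
Qed.

(** * The double complex computing the cohomology of Z_2(j) *)

Section DoubleComplex.
Variable j : int.

Definition chi (h : G1) : Z2 := val h ^ j.

Lemma chi1 : chi 1%g = 1. Proof. exact: exp1rz. Qed.

Lemma chiM g h : chi (g * h)%g = chi g * chi h.
Proof.
apply: exprMz_comm; [exact: (valP g)|exact: (valP h)|exact: mulrC].
Qed.

Lemma chiV g : chi g * chi g^-1%g = 1.
Proof. by rewrite -chiM mulgV chi1. Qed.

Lemma ucont_chiV k (i : 'I_k) : ucont (fun g => chi (g i)^-1%g).
Proof.
rewrite /chi; under [X in ucont X]eq_fun do rewrite /= exprz_inv.
exact: ucont_char.
Qed.

(* The embedding of C^b(G, Z_2(j)) as the invariants of [act]. *)
Definition coind_of b (f : ('I_b -> G1) -> Z2) : coind b :=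
  fun g => chi (g ord0) * f (gtail g).

(** Left translation of x twisted by the character; it commutes with the right translation by g_1 in
    [bar]. *)
Definition act b h (F : coind b) : coind b := fun g => chi h * F (gmul h^-1%g g).

Lemma act_mul b g h (F : coind b) : act (g * h)%g F = act g (act h F).
Proof.
by apply/funext => x; rewrite /act chiM mulrA invgM gmulM.
Qed.

Lemma act1 b (F : coind b) : act 1%g F = F.
Proof. by apply/funext => x; rewrite /act chi1 mul1r invg1 gmul1. Qed.

Lemma actB b h (F H : coind b) : act h (F - H) = act h F - act h H.
Proof. by apply/funext => x; rewrite /act !fctE mulrBr. Qed.

Lemma actZ b h c (F : coind b) : act h (fun g => c * F g) = fun g => c * act h F g.
Proof. by apply/funext => x; rewrite /act mulrCA. Qed.

Lemma bar_act b h (F : coind b) : bar (act h F) = act h (bar F).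
Proof.
apply/funext => g; rewrite /act barZ; congr (_ * _).
exact: (congr1 (@^~ g) (bar_gmul _ F)).
Qed.

Lemma ucont_act b h (F : coind b) : ucont F -> ucont (act h F).
Proof.
move=> uF; apply: ucontZ.
by apply: (ucont_comp _ uF) => n x y; apply: eqv_gmul.
Qed.

Lemma ucont_bar b (F : coind b) : ucont F -> ucont (bar F).
Proof.
move=> uF; apply: ucontD; last first.
  apply: ucontZ.
  by apply: (ucont_comp _ uF) => n x y xy i; apply: xy.
apply: ucont_sum => i; apply: ucontZ.
apply: (ucont_comp _ uF) => n x y xy i'; rewrite /Defs.merge.
by case: ifP => // _; case: ifP => // _; apply: congM.
Qed.

(* sigma - 1 for even a and sigma + 1 for odd a, where sigma is the action of -1. *)
Definition tau a b (F : coind b) : coind b :=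
  act negone F - (fun g => (-1) ^+ a * F g).

Definition phi1 b (F : coind b) : coind b := act five F - F.

Lemma tauB a b (F H : coind b) : tau a (F - H) = tau a F - tau a H.
Proof. by apply/funext => g; rewrite /tau actB !fctE; ring. Qed.

Lemma phi1B b (F H : coind b) : phi1 (F - H) = phi1 F - phi1 H.
Proof. by apply/funext => g; rewrite /phi1 actB !fctE; ring. Qed.

Lemma tau_act a b h (F : coind b) : tau a (act h F) = act h (tau a F).
Proof. by rewrite /tau actB (actZ h ((-1) ^+ a)) -!act_mul G1mulC. Qed.

Lemma tau_phi1 a b (F : coind b) : tau a (phi1 F) = phi1 (tau a F).
Proof. by rewrite /phi1 tauB tau_act. Qed.

Lemma tauSS a b (F : coind b) : tau a.+2 F = tau a F.
Proof. by apply/funext => g; rewrite /tau !fctE !exprS; ring. Qed.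

Lemma signr_mul a : (-1) ^+ a * (-1) ^+ a = 1 :> Z2.
Proof. by rewrite -exprD addnn -mul2n exprM sqrrN expr1n expr1n. Qed.

(** With e = (-1)^a, this is (sigma + e)(sigma - e) = sigma^2 - 1 = 0. *)
Lemma tau_tau a b (F : coind b) : tau a.+1 (tau a F) = 0.
Proof.
have -> : tau a.+1 (tau a F) = act negone (act negone F)
    - (fun g => (-1) ^+ a * act negone F g) - (fun g => (-1) ^+ a.+1 * tau a F g).
  by rewrite [LHS]/tau {1}/tau actB (actZ negone ((-1) ^+ a)).
rewrite -act_mul negoneK act1; apply/funext => g; rewrite /tau !fctE exprS.
transitivity (F g - (-1) ^+ a * (-1) ^+ a * F g); first by ring.
by rewrite signr_mul mul1r subrr.
Qed.

Lemma bar_tau a b (F : coind b) : bar (tau a F) = tau a (bar F).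
Proof. by rewrite /tau barB (barZ ((-1) ^+ a)) bar_act. Qed.

Lemma bar_phi1 b (F : coind b) : bar (phi1 F) = phi1 (bar F).
Proof. by rewrite /phi1 barB bar_act. Qed.

Lemma ucont_sub b (F H : coind b) : ucont F -> ucont H -> ucont (F - H).
Proof. exact: ucontB. Qed.

Lemma ucont_tau a b (F : coind b) : ucont F -> ucont (tau a F).
Proof.
move=> uF; apply: ucont_sub; first exact: ucont_act.
exact: ucontZ.
Qed.

Lemma ucont_phi1 b (F : coind b) : ucont F -> ucont (phi1 F).
Proof. by move=> uF; apply: ucont_sub (ucont_act _ uF) uF. Qed.

Lemma ucont_pos4 b : ucont (fun g : 'I_b.+1 -> G1 => (pos4 (g ord0))%:R).
Proof.
by move=> m; exists 2 => g h gh; rewrite (pos4_cong (gh ord0)); apply: cong_refl.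
Qed.

Lemma tau_exact a b (F : coind b) : ucont F -> tau a.+1 F = 0 ->
  exists2 H, ucont H & tau a H = F.
Proof.
move=> uF /(congr1 (fun F : coind b => F _)) tF.
(* Up to sign, F cut off to the fundamental domain D. As sigma F = -(-1)^a F and sigma exchanges D
   with its complement, [tau a] of this is F on both halves. *)
exists (fun g => - (-1) ^+ a * ((pos4 (g ord0))%:R * F g)).
  by apply/ucontZ/ucontM; first exact: ucont_pos4.
apply/funext => g; have := tF g; rewrite /tau /act !fctE exprS => sF.
have {sF} : chi negone * F (gmul negone^-1%g g) = - (-1) ^+ a * F g.
  by apply/eqP; rewrite -subr_eq0 -[X in _ == X]sF; apply/eqP; ring.
have -> : negone^-1%g = negone by apply: (mulgI negone); rewrite mulgV negoneK.
move=> sF; rewrite /gmul gcons0 pos4_neg -/(gmul _ _) mulrCA [X in _ * X]mulrCA sF.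
rewrite (_ : _ - _ = (-1) ^+ a * (-1) ^+ a *
  (((~~ pos4 (g ord0))%:R + (pos4 (g ord0))%:R) * F g)); last by ring.
by rewrite signr_mul mul1r; case: (pos4 _); rewrite /= ?add0r ?addr0 mul1r.
Qed.

Lemma phi1_exact b (F : coind b) : ucont F -> exists2 H, ucont H & phi1 H = F.
Proof.
move=> uF.
(* Writing H = chi psi turns phi H - H = F into psi(x/5) - psi(x) = F(x)/chi(x). Replacing x by 5x
   gives the shift and the sign in [q]. *)
pose q g := - (chi (gmul five g ord0)^-1%g * F (gmul five g)).
have [|psi [upsi psiE]] := @five_primitive b q.
  suff: ucont (fun g : 'I_b.+1 -> G1 => -1 * (chi (g ord0)^-1%g * F g)).
    move=> /(@ucont_comp _ _ (gmul five) _ (fun n => @eqv_gmul n _ five)).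
    by rewrite /q; under [in X in _ -> X]eq_fun do rewrite -mulN1r.
  by apply/ucontZ/ucontM; first exact: ucont_chiV.
exists (fun g => chi (g ord0) * psi g).
  by apply: ucontM; first exact: ucont_char.
apply/funext => g; rewrite /phi1 /act !fctE {1}/gmul gcons0 mulrA -chiM mulVKg.
rewrite -mulrBr; have := psiE (gmul five^-1%g g).
rewrite /q -!gmulM mulgV gmul1 => /(congr1 -%R); rewrite opprB opprK => ->.
by rewrite mulrA chiV mul1r.
Qed.

(** Divided by chi(x), an invariant F is unchanged by 5 and -1 acting on x, hence constant in x by
    density. *)
Lemma act_invariant b (F : coind b) : ucont F -> tau 0 F = 0 -> phi1 F = 0 ->
  F = coind_of (fun g => F (gcons 1%g g)).
Proof.
move=> uF t0 p0.
pose psi g := chi (g ord0)^-1%g * F g.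
have upsi : ucont psi by apply: ucontM; first exact: ucont_chiV.
have inv h : act h F = F -> forall g, psi (gmul h g) = psi g.
  move=> hF g; rewrite /psi -{1}hF /act -gmulM mulVg gmul1 mulrA -chiM.
  by rewrite /gmul gcons0 invgM -mulgA mulVg mulg1.
have eqact h : act h F - F = 0 -> act h F = F by move/eqP; rewrite subr_eq0 => /eqP.
have psi1 := five_neg_invariant upsi (inv _ (eqact _ p0)).
have {}psi1 : forall g, psi g = psi (gcons 1%g (gtail g)).
  apply: psi1; apply: inv; apply: eqact; rewrite -[RHS]t0 /tau.
  by congr (_ - _); apply/funext => g; rewrite expr0 mul1r.
apply/funext => g; rewrite /coind_of; have := psi1 g.
rewrite /psi gcons0 invg1 chi1 mul1r => <-.
by rewrite mulrA chiV mul1r.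
Qed.

Lemma coind_of_act b h (f : ('I_b -> G1) -> Z2) : act h (coind_of f) = coind_of f.
Proof.
apply/funext => g; rewrite /act /coind_of /gmul gcons0 gtail_cons mulrA -chiM.
by rewrite mulVKg.
Qed.

Lemma ucont_coind_of b (f : ('I_b -> G1) -> Z2) : ucont (coind_of f) <-> ucont f.
Proof.
split=> uf; last first.
  apply: ucontM; first exact: ucont_char.
  by apply: (ucont_comp _ uf) => n x y xy i; apply: xy.
have -> : f = (fun g => coind_of f (gcons 1%g g)).
  by apply/funext => g; rewrite /coind_of gcons0 chi1 mul1r gtail_cons.
by apply: (ucont_comp _ uf) => n x y; apply/eqv_gcons/cong_refl.
Qed.

(* The double complex of pairs (u, v), with v = 0 in column 0. The horizontal
   direction is the tensor product of the complex phi - 1 of length one with the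
   periodic resolution of {1, -1}. *)
Definition bidegree a b (x : coind b * coind b) :=
  [/\ ucont x.1, ucont x.2 & a = 0%N -> x.2 = 0].

(** In column a the second component sits at step a - 1 of the periodic complex, whose map is that
    of step a + 1. The minus sign makes the two mixed terms cancel in the square. *)
Definition dh a b (x : coind b * coind b) : coind b * coind b :=
  (tau a x.1, phi1 x.1 - tau a.+1 x.2).

Definition dv b (x : coind b * coind b) : coind b.+1 * coind b.+1 :=
  (bar x.1, bar x.2).

Lemma bidegreeB a b (x y : coind b * coind b) :
  bidegree a x -> bidegree a y -> bidegree a (x - y).
Proof.
case: x y => [u v] [u' v'] [/= uu uv v0] [/= uu' uv' v0'].
split; try exact: ucont_sub.
by move=> a0; rewrite /= v0 // v0' // subrr.
Qed.

Lemma dhB a b (x y : coind b * coind b) : dh a (x - y) = dh a x - dh a y.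
Proof.
rewrite /dh /= tauB phi1B tauB; congr pair.
by rewrite /= !opprD !opprK addrACA.
Qed.

Lemma dvB b (x y : coind b * coind b) : dv (x - y) = dv x - dv y.
Proof. by rewrite /dv /= !barB. Qed.

Lemma bidegree_dh a b (x : coind b * coind b) :
  bidegree a x -> bidegree a.+1 (dh a x).
Proof.
case=> uu uv _; split=> //; first exact: ucont_tau.
exact: ucont_sub (ucont_phi1 uu) (ucont_tau _ uv).
Qed.

Lemma bar0 b : bar (0 : coind b) = 0.
Proof. by rewrite -(subrr (0 : coind b)) barB !subrr. Qed.

Lemma tau0 a b : tau a (0 : coind b) = 0.
Proof. by rewrite -(subrr (0 : coind b)) tauB !subrr. Qed.

Lemma bidegree_dv a b (x : coind b * coind b) : bidegree a x -> bidegree a (dv x).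
Proof.
by case=> uu uv v0; split; [apply: ucont_bar..|move=> /v0 /= ->; apply: bar0].
Qed.

Lemma dh_dv a b (x : coind b * coind b) : dh a (dv x) = dv (dh a x).
Proof. by rewrite /dh /dv /= barB !bar_tau bar_phi1. Qed.

Lemma dh_dh a b (x : coind b * coind b) : dh a.+1 (dh a x) = 0.
Proof. by rewrite /dh /= tau_tau tauB tauSS tau_phi1 tau_tau subr0 subrr. Qed.

Lemma dv_dv b (x : coind b * coind b) : dv (dv x) = 0.
Proof. by rewrite /dv /= !bar_bar. Qed.

Lemma bar_exact b (F : coind b.+1) : bar F = 0 ->
  bar (fun g => F (gcons 1%g g)) = F.
Proof.
by move=> F0; apply/funext => g; rewrite -[RHS]bar_cons1 F0 add0r.
Qed.

Lemma dv_exact a b (x : coind b.+1 * coind b.+1) : bidegree a x -> dv x = 0 ->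
  exists2 y, bidegree a y & dv y = x.
Proof.
case: x => u v [/= uu uv v0] [bu bv].
exists (fun g => u (gcons 1%g g), fun g => v (gcons 1%g g)).
  split=> /=; last by move=> /v0 ->.
    by apply: (ucont_comp _ uu) => n g h; apply/eqv_gcons/cong_refl.
  by apply: (ucont_comp _ uv) => n g h; apply/eqv_gcons/cong_refl.
by rewrite /dv /= !bar_exact.
Qed.

Lemma dh_exact a b (x : coind b * coind b) : bidegree a.+1 x -> dh a.+1 x = 0 ->
  exists2 y, bidegree a y & dh a y = x.
Proof.
case: x => u v [/= uu uv _] [tu /eqP]; rewrite tauSS subr_eq0 => /eqP pu.
have [p up pE] := tau_exact uu tu.
have tw : tau a.+2 (phi1 p - v) = 0.
  by rewrite tauSS tauB tau_phi1 pE pu subrr.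
have [q uq qE] := tau_exact (ucont_sub (ucont_phi1 up) uv) tw.
case: a => [|a] in tu pu pE tw qE *; last first.
  by exists (p, q); rewrite /dh /= ?pE ?qE ?subKr.
(* In column 0 the second component must vanish: with q = phi1 r, it is absorbed into p, since phi1
   (tau 1 r) = tau 1 q. *)
have [r ur rE] := phi1_exact uq.
exists (p - tau 1 r, 0).
  split=> //; last exact: ucont_cst.
  exact: ucont_sub up (ucont_tau _ ur).
rewrite /dh /= tau0 subr0 tauB pE -(tauSS 0) tau_tau subr0 phi1B -tau_phi1 rE qE.
by rewrite subKr.
Qed.
End DoubleComplex.

(** * Quotient groups, and the cohomology of [E_mod t] at the edge of the double complex *)

Local Open Scope quotient_scope.
Local Open Scope ring_scope.

Lemma surj_inj_bijective (A B : Type) (f : A -> B) :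
  injective f -> (forall y, exists x, f x = y) -> bijective f.
Proof.
move=> inj_f /choice[g gE]; exists g => [x|y]; last exact: gE.
by apply: inj_f; rewrite gE.
Qed.

Lemma zmod_iso_of_surj (A B : zmodType) (f : A -> B) :
  zmod_morphism f -> (forall x, f x = 0 -> x = 0) ->
  (forall y, exists x, f x = y) -> zmod_iso A B.
Proof.
move=> fB f_inj f_surj.
pose F := GRing.isZmodMorphism.Build A B f fB.
pose g : {additive A -> B} := HB.pack f F.
exists g; apply: surj_inj_bijective => //= x y xy.
by apply/eqP; rewrite -subr_eq0; apply/eqP/f_inj; rewrite fB xy subrr.
Qed.

Lemma quot_eq0 (V : zmodType) (I : zmodClosed V) (v : V) :
  v \in I <-> \pi_(Quotient.quot I) v = 0.
Proof.
rewrite -[v in v \in I]subr0 Quotient.idealrBE raddf0.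
by split=> [/eqP|->].
Qed.

(** First isomorphism theorem: [f] takes the same value on all representatives of a class, so
    [f \o repr] is additive. *)
Lemma zmod_iso_quot (V X : zmodType) (I : zmodClosed V) (f : V -> X) :
  zmod_morphism f -> (forall v, f v = 0 <-> v \in I) ->
  (forall x, exists v, f v = x) -> zmod_iso (Quotient.quot I) X.
Proof.
move=> fB fI f_surj.
have f_repr v : f (repr (\pi_(Quotient.quot I) v)) = f v.
  apply/eqP; rewrite -subr_eq0 -fB; apply/eqP/fI/quot_eq0.
  by rewrite raddfB /= reprK subrr.
apply: (@zmod_iso_of_surj _ _ (f \o repr)) => [x y|x /fI/quot_eq0|x] /=.
- apply/eqP; rewrite -fB -subr_eq0 -fB; apply/eqP/fI/quot_eq0.
  by rewrite !raddfB /= !reprK -opprD subrr.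
- by rewrite reprK.
by have [v <-] := f_surj x; exists (\pi v).
Qed.

Lemma coind_of_inj j b (f f' : ('I_b -> G1) -> Z2) :
  coind_of j f = coind_of j f' -> f = f'.
Proof.
move=> ff'; apply/funext => g; have := congr1 (@^~ (gcons 1%g g)) ff'.
by rewrite /coind_of gcons0 gtail_cons chi1 !mul1r.
Qed.

Section EvenCohomology.
Variables (t : int) (t_even : (2 %| t)%Z).
Let j := (t %/ 2)%Z.
Let N := E_mod t.

Lemma coefMz (x : E t) n : coef (x *~ n) = n%:~R * coef x :> Z2.
Proof.
case: n => n; rewrite ?NegzE ?mulrNz -?pmulrn; first by rewrite coefMn -mulr_natl.
by rewrite -[LHS]/(- coef (x *+ n.+1)) coefMn -mulr_natl mulNr.
Qed.

Lemma coef_sum (I : Type) (r : seq I) (F : I -> E t) :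
  coef (\sum_(i <- r) F i) = \sum_(i <- r) (coef (F i) : Z2).
Proof. by elim/big_rec2: _ => // i x y _ <-. Qed.

(** The first face replaces x by x g_1, and chi(x g_1) = chi(x) chi(g_1) produces the action of g_1
    on the coefficients. *)
Lemma bar_coind_of k (f : {ptws 'I_k -> G1} -> N) :
  bar (coind_of j (fun g => coef (f g))) =
  coind_of j (fun g => coef (cdiff_fun f g)).
Proof.
apply/funext => g; rewrite /bar /coind_of /cdiff_fun.
rewrite big_ord_recl expr0 mul1r merge0 gcons0 gtail_cons.
under eq_bigr do rewrite mergeS gcons0 gtail_cons.
rewrite (coefD (_ + _)) coefD coef_sum coefMz.
under [in RHS]eq_bigr do rewrite coefMz.
rewrite chiM !mulrDr mulr_sumr -!mulrA; congr (_ + _ + _).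
  apply: eq_bigr => i _; rewrite lift0 mulrCA; congr (_ * (_ * _)).
  by rewrite rmorphXn /= rmorphN1.
rewrite /ginit widen_ord00 mulrCA rmorphXn /= rmorphN1.
by congr (_ * (_ * coef (f _))); apply: gtail_init.
Qed.

Definition cochain_coef k (f : cochain N k) : ('I_k -> G1) -> Z2 :=
  fun g => coef (f g).

Lemma ucont_cochain k (f : cochain N k) : ucont (cochain_coef f).
Proof. exact/(continuous_ucont t_even)/asboolP/(cochainP f). Qed.

Lemma cochain_of_ucont k (f : ('I_k -> G1) -> Z2) : ucont f ->
  exists c : cochain N k, cochain_coef c = f.
Proof.
move=> uf; have cP : (fun g => ofcoef t_even (f g)) \in @continuous_fct _ N k.
  by apply/asboolP/(continuous_ucont t_even).
by exists (Cochain cP).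
Qed.

Lemma cochain_coef_inj k : injective (@cochain_coef k).
Proof.
move=> f f' ff'; apply/val_inj/funext => g; apply: val_inj.
exact: (congr1 (@^~ g) ff').
Qed.

Lemma cochain_coefB k (f f' : cochain N k) :
  cochain_coef (f - f') = cochain_coef f - cochain_coef f'.
Proof. by []. Qed.

Lemma cochain_coef0 k : cochain_coef (0 : cochain N k) = 0.
Proof. by []. Qed.

Lemma bar_cochain k (f : cochain N k) :
  bar (coind_of j (cochain_coef f)) = coind_of j (cochain_coef (cdiff f)).
Proof. exact: bar_coind_of. Qed.

Lemma coind_of0 k : coind_of j (0 : ('I_k -> G1) -> Z2) = 0.
Proof. by apply/funext => g; rewrite /coind_of mulr0. Qed.

Lemma coind_ofB k (f f' : ('I_k -> G1) -> Z2) :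
  coind_of j (f - f') = coind_of j f - coind_of j f'.
Proof. by apply/funext => g; rewrite /coind_of !fctE mulrBr. Qed.

Lemma dh0_coind_of k (f : ('I_k -> G1) -> Z2) :
  dh j 0 (coind_of j f, 0 : coind k) = 0.
Proof.
rewrite /dh /= tau0 /phi1 coind_of_act subr0 subrr /tau coind_of_act.
congr pair; apply/funext => g.
by rewrite !fctE expr0 mul1r subrr.
Qed.

Lemma dh0_invariant k (x : coind k * coind k) :
  bidegree 0 x -> dh j 0 x = 0 ->
  exists2 f, ucont f & x = (coind_of j f, 0).
Proof.
case: x => u v [/= uu _ /(_ erefl) ->]; rewrite /dh /= tau0 subr0 => -[tu pu].
have uE := act_invariant uu tu pu.
exists (fun g => u (gcons 1%g g)); last by rewrite -uE.
by apply/(ucont_coind_of j); rewrite -uE.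
Qed.

Notation jbicocycle := (bicocycle bidegree (dh j) dv).
Notation jhboundary := (hboundary bidegree (dh j) dv).
Notation jvboundary := (vboundary bidegree (dh j) dv).

(** The kernel of [dh] in column 0 is the image of [coind_of], which carries [cdiff] to [bar]; so
    [iota] matches cocycles and coboundaries. *)
Lemma zmod_iso_cohomology n (X : zmodType) :
  presents X (@jbicocycle 0 n.+1) (@jvboundary 0 n) ->
  zmod_iso (cohomology N n.+1) X.
Proof.
case=> h [hB hsurj hker].
pose iota (z : cocycle N n.+1) : coind n.+1 * coind n.+1 :=
  (coind_of j (cochain_coef z), 0).
have iotaZ z : jbicocycle 0 (iota z).
  split; last 1 first.
  - rewrite /dv /= bar0 bar_cochain.
    by have /eqP -> := cocycleP z; rewrite coind_of0.
  - split=> //=; last exact: ucont_cst.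
    exact/ucont_coind_of/ucont_cochain.
  exact: dh0_coind_of.
have iotaB z z' : iota (z - z') = iota z - iota z'.
  by rewrite /iota cochain_coefB coind_ofB; congr pair; rewrite subr0.
have iota0 z : h (iota z) = 0 <-> z \in @is_coboundary _ N n.+1.
  rewrite hker //; split=> [[y [Py yh yz]]|/asboolP[f fz]].
    apply/asboolP; have [f uf yE] := dh0_invariant Py yh.
    have [c cE] := cochain_of_ucont uf; exists c; apply: cochain_coef_inj.
    apply: (@coind_of_inj j); rewrite -bar_cochain cE.
    by move: yz; rewrite yE /dv /= => -[].
  exists (coind_of j (cochain_coef f), 0); split.
  - split=> //=; last exact: ucont_cst.
    exact/ucont_coind_of/ucont_cochain.
  - exact: dh0_coind_of.
  - by rewrite /dv /= bar0 bar_cochain fz.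
apply: (@zmod_iso_quot _ _ _ (h \o iota)) => [z z'|//|x] /=.
  by rewrite iotaB hB.
have [[u v] [Pz zh zv] <-] := hsurj x.
have [f uf uE] := dh0_invariant Pz zh.
have [c cE] := cochain_of_ucont uf.
have cz : c \in @is_cocycle _ N n.+1.
  apply/eqP/cochain_coef_inj/(@coind_of_inj j).
  by move: zv; rewrite -bar_cochain cE uE /dv /= coind_of0 => -[].
by exists (Cocycle cz); rewrite /iota /= cE uE.
Qed.

(** The staircase from column n + 1, row 0 to column 0, row n + 1. *)
Lemma zmod_iso_small n (X : zmodType) :
  presents X (@jbicocycle n.+1 0) (@jhboundary n 0) ->
  zmod_iso (cohomology N n.+1) X.
Proof.
move=> pX; apply: zmod_iso_cohomology.
apply: (staircase _ _ _ _ _ _ _ _ _ _ pX) => *; [exact: bidegreeB|exact: dhB|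
  exact: dvB|exact: bidegree_dh|exact: bidegree_dv|exact: dh_dv|exact: dh_dh|
  exact: dv_dv|exact: dh_exact|exact: dv_exact].
Qed.
End EvenCohomology.

(** * The small complex *)

Section SmallComplex.
Variable j : int.

Notation jbicocycle := (bicocycle bidegree (dh j) dv).
Notation jhboundary := (hboundary bidegree (dh j) dv).

Definition tau_scalar a : Z2 := chi j negone - (-1) ^+ a.
Definition phi_scalar : Z2 := chi j five - 1.

Definition cst0 (x : Z2) : coind 0 := fun=> x.

Lemma tau_cst a x : tau j a (cst0 x) = cst0 (tau_scalar a * x).
Proof. by apply/funext => g; rewrite /tau /act !fctE /cst0 mulrBl. Qed.

Lemma phi1_cst x : phi1 j (cst0 x) = cst0 (phi_scalar * x).
Proof. by apply/funext => g; rewrite /phi1 /act !fctE /cst0 mulrBl mul1r. Qed.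

Lemma cst0B x y : cst0 x - cst0 y = cst0 (x - y).
Proof. by []. Qed.

Lemma cst0_inj : injective cst0.
Proof. by move=> x y /(congr1 (@^~ (fun=> 1%g))). Qed.

Lemma bar0_eq0 (F : coind 0) : bar F = 0 -> F = cst0 (F (fun=> 1%g)).
Proof.
move=> F0; apply/funext => g; apply/eqP; rewrite -subr_eq0 -bar0_cons1 F0.
exact: eqxx.
Qed.

Lemma bidegree_cst a u v : (a = 0%N -> v = 0) -> bidegree a (cst0 u, cst0 v).
Proof. by move=> v0; split=> /=; try exact: ucont_cst; move=> /v0 ->. Qed.

Lemma dh_cst a u v : dh j a (cst0 u, cst0 v) =
  (cst0 (tau_scalar a * u), cst0 (phi_scalar * u - tau_scalar a.+1 * v)).
Proof. by rewrite /dh /= !tau_cst phi1_cst cst0B. Qed.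

Lemma tau_scalarSS a : tau_scalar a.+2 = tau_scalar a.
Proof. by rewrite /tau_scalar !exprS !mulN1r opprK. Qed.

(** In row 0 the kernel of [dv] consists of pairs of constants, on which [tau] and [phi1] are
    multiplication by scalars. *)
Lemma presents_small a (X : zmodType) (f : Z2 * Z2 -> X) :
  zmod_morphism f ->
  (forall x, exists u v, [/\ tau_scalar a.+1 * u = 0,
     phi_scalar * u = tau_scalar a.+2 * v & f (u, v) = x]) ->
  (forall u v, tau_scalar a.+1 * u = 0 ->
     phi_scalar * u = tau_scalar a.+2 * v ->
     f (u, v) = 0 <-> exists p q, [/\ a = 0%N -> q = 0, u = tau_scalar a * p &
       v = phi_scalar * p - tau_scalar a.+1 * q]) ->
  presents X (@jbicocycle a.+1 0) (@jhboundary a 0).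
Proof.
move=> fB f_surj f_ker.
have cocycleE u v : jbicocycle a.+1 (cst0 u, cst0 v) <->
    tau_scalar a.+1 * u = 0 /\ phi_scalar * u = tau_scalar a.+2 * v.
  rewrite /bicocycle dh_cst; split.
    case=> _ [/cst0_inj -> /cst0_inj/eqP]; rewrite subr_eq0 => /eqP uv _.
    by split.
  move=> [u0 uv]; split; first exact: bidegree_cst.
    by rewrite u0 uv subrr.
  by rewrite /dv /= !bar_cst.
have cocycle_cst x : jbicocycle a.+1 x ->
    x = (cst0 (x.1 (fun=> 1%g)), cst0 (x.2 (fun=> 1%g))).
  by case: x => u v [_ _ [bu bv]] /=; rewrite -!bar0_eq0.
exists (fun x => f (x.1 (fun=> 1%g), x.2 (fun=> 1%g))); split.
- by move=> z z' _ _; rewrite -fB.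
- move=> x; have [u [v [u0 uv <-]]] := f_surj x.
  by exists (cst0 u, cst0 v) => //; apply/cocycleE.
move=> z Zz; have zE := cocycle_cst z Zz.
move: Zz; rewrite zE => /cocycleE[u0 uv]; rewrite /= f_ker //; split.
  case=> p [q [q0 uE vE]]; exists (cst0 p, cst0 q); split.
  - exact: bidegree_cst.
  - by rewrite /dv /= !bar_cst.
  - by rewrite dh_cst -uE -vE.
case=> -[p q] [[_ _ /= q0] [bp bq] pqE].
have pE := bar0_eq0 bp; have qE := bar0_eq0 bq.
exists (p (fun=> 1%g)), (q (fun=> 1%g)).
move: pqE; rewrite pE qE dh_cst => -[/cst0_inj <- /cst0_inj <-].
by split=> // /q0 ->.
Qed.

(** The character takes the value (-1)^j at -1; [s] is this sign. *)
Lemma tau_scalar_case a : exists2 s : Z2, s * s = 1 &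
  tau_scalar a = if odd a == odd `|j|%N then 0 else 2 * s.
Proof.
have -> : tau_scalar a = (-1) ^+ odd `|j|%N - (-1) ^+ odd a.
  rewrite /tau_scalar !signr_odd /chi; congr (_ - _).
  by case: j => n //; rewrite NegzE -exprz_inv /= invrN1.
exists ((-1) ^+ odd `|j|%N); first exact: signr_mul.
by do 2!case: (odd _); rewrite /= ?expr1 ?expr0; ring.
Qed.
End SmallComplex.

Lemma chi_five (k : nat) (m : int) : ~~ (2 %| m)%Z ->
  exists2 w : Z2, w \is a GRing.unit &
    phi_scalar (2 ^+ k * m) = 2 ^+ k.+2 * w.
Proof.
move=> m_odd.
have odd_m : odd `|m|%N by rewrite -[odd _]negbK -dvdn2.
have [y yE] := exp5_odd k odd_m; have wU := Z2_odd_unit y.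
have jE : `|(2 ^+ k * m)%R|%N = (2 ^ k * `|m|)%N by rewrite abszM abszX.
have [s0|s0] := leP 0 m.
  exists (1 + 2 * y) => //; rewrite /phi_scalar /chi val_five.
  have -> : 2 ^+ k * m = `|(2 ^+ k * m)%R|%N :> int.
    by rewrite gez0_abs // mulr_ge0 // exprn_ge0.
  by rewrite -exprnP jE yE addrAC subrr add0r.
set x : Z2 := 5 ^+ (2 ^ k * `|m|) in yE *.
have xU : x \is a GRing.unit by apply: exp5_unit.
(* For a negative exponent, 1/x - 1 = -(x - 1)/x. *)
exists (- (x^-1 * (1 + 2 * y))); first by rewrite unitrN unitrM unitrV xU.
rewrite /phi_scalar /chi val_five.
have -> : 2 ^+ k * m = - (`|(2 ^+ k * m)%R|%N)%:Z :> int.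
  by rewrite lez0_abs ?opprK // mulr_ge0_le0 ?exprn_ge0 // ltW.
rewrite -exprz_inv -exprnP jE exprVn -/x.
apply: (mulrI xU); rewrite mulrBr divrr // mulr1.
have -> : x * (2 ^+ k.+2 * - (x^-1 * (1 + 2 * y))) =
  - ((x / x) * (2 ^+ k.+2 * (1 + 2 * y))) by ring.
by rewrite divrr // yE; ring.
Qed.

Lemma int_pow2_odd (j : int) : j <> 0 ->
  exists (k : nat) (m : int), ~~ (2 %| m)%Z /\ j = 2 ^+ k * m.
Proof.
move=> /eqP j0; have /nat_pow2_odd[k [m [m_odd mE]]] : (0 < `|j|)%N.
  by rewrite absz_gt0.
exists k, (Num.sg j * m); split.
  by rewrite dvdzE abszM absz_sg j0 mul1n /= dvdn2 m_odd.
by rewrite mulrCA [LHS]numEsg -abszE mE PoszM -natrX natz.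
Qed.

Lemma phi_scalar_even (j : int) : exists c, phi_scalar j = 2 * c.
Proof.
have : val five ^ j \is a GRing.unit by apply: unitrXz; apply: (valP five).
by move=> /Z2_unit_odd[y yE]; exists y; rewrite /phi_scalar /chi yE; ring.
Qed.

(** * Cohomology of the small complex in positive degrees *)

Section Targets.
Variable j : int.
Notation jbicocycle := (bicocycle bidegree (dh j) dv).
Notation jhboundary := (hboundary bidegree (dh j) dv).

Definition red n (x : Z2) : 'Z_(2 ^ n.+1) := x n.

Lemma redB n : zmod_morphism (red n). Proof. by []. Qed.

Lemma red_eq0 n x : red n x = 0 <-> exists y, x = 2 ^+ n.+1 * y.
Proof.
split=> [|[y yE]]; first exact: Z2_divisible.
apply/(cong_level n x 0); exists y; rewrite yE; ring.
Qed.

Lemma red_surj n y : exists x, red n x = y.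
Proof. by exists (val y)%:R; rewrite /red Z2_level_nat natr_Zp. Qed.

(** One of tau_a and tau_(a+1) is 0 and the other is 2 up to sign. If tau_a = 0, then u = 0 and the
    class is v modulo 2, because 5^j - 1 is even. Otherwise u determines v and the class is u modulo
    2. The hypothesis excludes a = 0 with j even, where q = 0 is forced. *)
Lemma presents_Z2_quotient a : (0 < a)%N || odd `|j| ->
  presents ('Z_2 : zmodType) (@jbicocycle a.+1 0) (@jhboundary a 0).
Proof.
move=> aj; have [c cE] := phi_scalar_even j.
have [s ss sE] := tau_scalar_case j a.
have [s' ss' s'E] := tau_scalar_case j a.+1.
have e2 := tau_scalarSS j a.
have sK x : s * (s * x) = x by rewrite mulrA ss mul1r.
have s'K x : s' * (s' * x) = x by rewrite mulrA ss' mul1r.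
have [aj_parity|aj_parity] := boolP (odd a == odd `|j|%N).
  have e0 : tau_scalar j a = 0 by rewrite sE aj_parity.
  have e1 : tau_scalar j a.+1 = 2 * s'.
    by rewrite s'E /=; move: aj_parity; case: (odd a); case: (odd _).
  have a0 : a <> 0%N by move=> a0; move: aj aj_parity; rewrite a0 /= => ->.
  apply: (@presents_small j a _ (fun x => red 0 x.2)) => [x y|x|u v];
    rewrite ?e2 ?e0 ?e1.
  - exact: redB.
  - have [v vE] := red_surj x; exists 0, v; rewrite vE !mulr0 mul0r; split=> //.
  move=> /= su uv; have u0 : u = 0.
    apply: Z2_mul2I; rewrite mulr0.
    rewrite -(s'K (2 * u)) (_ : s' * (2 * u) = 2 * s' * u).
      by rewrite su mulr0.
    by ring.
  rewrite red_eq0 expr1; split=> [[w wE]|[p [q [_ _ ->]]]].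
    exists 0, (- s' * w); rewrite u0 wE; split=> //; first by ring.
    by rewrite -[in LHS](s'K w); ring.
  by exists (c * p - s' * q); rewrite cE; ring.
have e1 : tau_scalar j a.+1 = 0.
  by rewrite s'E /=; move: aj_parity; case: (odd a); case: (odd _).
have e0 : tau_scalar j a = 2 * s by rewrite sE (negPf aj_parity).
apply: (@presents_small j a _ (fun x => red 0 x.1)) => [x y|x|u v];
    rewrite ?e2 ?e0 ?e1.
- exact: redB.
(* The cocycle condition reads 2cu = 2sv, and s is its own inverse. *)
- have [u uE] := red_surj x; exists u, (s * c * u); rewrite uE mul0r; split=> //.
  rewrite -(sK (phi_scalar j * u)) cE; ring.
move=> /= _ uv; rewrite red_eq0 expr1; split=> [[w wE]|[p [q [_ -> _]]]]; last first.
  by exists (s * p); ring.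
exists (s * w), 0; split=> //.
  by rewrite wE -[in LHS](sK w); ring.
rewrite mul0r subr0; apply: Z2_mul2I; rewrite -(sK (2 * v)).
have -> : s * (s * (2 * v)) = s * (2 * s * v) by ring.
by rewrite -uv cE wE; ring.
Qed.

(* In degree 1 with j even, the complex reduces to Z_2 --(5^j - 1)--> Z_2. *)
Lemma presents_degree1 (X : zmodType) (f : Z2 -> X) : ~~ odd `|j| ->
  zmod_morphism f -> (forall x, exists v, f v = x) ->
  (forall v, f v = 0 <-> exists p, v = phi_scalar j * p) ->
  presents X (@jbicocycle 1 0) (@jhboundary 0 0).
Proof.
move=> j_even fB f_surj f_ker.
have [s ss sE] := tau_scalar_case j 1.
have {}sE : tau_scalar j 1 = 2 * s by rewrite sE (negPf j_even).
have e0 : tau_scalar j 0 = 0.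
  by have [s0 _ ->] := tau_scalar_case j 0; rewrite (negPf j_even).
apply: (@presents_small j 0 _ (fun x => f x.2)) => [x y|x|u v] /=.
- exact: fB.
- have [v vE] := f_surj x.
  by exists 0, v; rewrite vE tau_scalarSS e0 !mulr0 mul0r.
rewrite sE => su _; have u0 : u = 0.
  apply: Z2_mul2I; rewrite mulr0.
  have -> : 2 * u = (s * s) * (2 * u) by rewrite ss mul1r.
  have -> : s * s * (2 * u) = s * (2 * s * u) by ring.
  by rewrite su mulr0.
rewrite f_ker; split=> [[p pE]|[p [q [q0 _ ->]]]].
  by exists p, 0; rewrite e0 mul0r mulr0 subr0.
by exists p; rewrite q0 // mulr0 subr0.
Qed.

Lemma presents_degree1_Z2 : j = 0 ->
  presents (Z2 : zmodType) (@jbicocycle 1 0) (@jhboundary 0 0).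
Proof.
move=> j0; apply: (@presents_degree1 _ id) => // [|x|v]; first by rewrite j0.
  by exists x.
have -> : phi_scalar j = 0 by rewrite /phi_scalar /chi j0 expr0z subrr.
by split=> [->|[p ->]]; [exists 0|]; rewrite mul0r.
Qed.

Lemma presents_degree1_cyclic k m : (0 < k)%N -> ~~ (2 %| m)%Z ->
  j = 2 ^+ k * m ->
  presents ('Z_(2 ^ k.+2) : zmodType) (@jbicocycle 1 0) (@jhboundary 0 0).
Proof.
move=> k0 m_odd jE; have [w wU wE] := chi_five k m_odd.
apply: (@presents_degree1 _ (red k.+1)) => [|x y|x|v].
- by rewrite jE abszM abszX oddM oddX eqn0Ngt k0.
- exact: redB.
- exact: red_surj.
rewrite red_eq0 jE wE; split=> -[p ->]; last by exists (w * p); rewrite mulrA.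
by exists (w^-1 * p); rewrite -mulrA mulVKr.
Qed.
End Targets.

(** * Invariants: cohomology in degree 0 *)

Section DegreeZero.
Variables (t : int) (t_even : (2 %| t)%Z).
Let j := (t %/ 2)%Z.

(** The embedded cocycle chi(x) z is killed by [bar], hence constant in x. *)
Lemma cocycle0_invariant (z : cocycle (E_mod t) 0) h :
  chi j h * coef (z (fun=> 1%g)) = coef (z (fun=> 1%g)).
Proof.
have pt (g : 'I_0 -> G1) : g = fun=> 1%g by apply/funext => -[].
have z0 : bar (coind_of j (cochain_coef z)) = 0.
  have /eqP cz := cocycleP z.
  by rewrite bar_cochain cz cochain_coef0 coind_of0.
have := congr1 (@^~ (gcons h (fun=> 1%g))) (bar0_eq0 z0).
rewrite /coind_of /cst0 gcons0 chi1 mul1r /cochain_coef.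
by rewrite (pt (gtail _)) (pt (gtail (fun=> 1%g))).
Qed.

(** Invariance under 5 gives (5^j - 1) z = 0 with j nonzero, and Z_2 is torsion-free. *)
Lemma cohomology0_eq0 (x : cohomology (E_mod t) 0) : t <> 0 -> x = 0.
Proof.
move=> t0; have j0 : j <> 0.
  move=> j0; apply: t0; move/dvdzP: t_even => [i tE].
  by move: j0; rewrite /j tE mulzK // => ->.
have [k [m [m_odd jE]]] := int_pow2_odd j0.
have [w wU wE] := chi_five k m_odd.
rewrite -[x]reprK; apply/quot_eq0/eqP/val_inj/val_inj/funext => g.
apply: val_inj; have -> : g = fun=> 1%g by apply/funext => -[].
have := cocycle0_invariant (repr x) five.
have -> : chi j five = 1 + 2 ^+ k.+2 * w by rewrite -wE -jE /phi_scalar addrC subrK.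
set z := coef _; rewrite mulrDl mul1r -[RHS]addr0 => /addrI z0.
change (z = 0); apply: (mulrI wU); apply: (@Z2_mul2XI k.+2).
by rewrite mulrA z0 !mulr0.
Qed.

Lemma zmod_iso_cohomology0 : t = 0 -> zmod_iso (cohomology (E_mod t) 0) Z2.
Proof.
move=> t0; have j0 : j = 0 by rewrite /j t0.
have pt (g : 'I_0 -> G1) : g = fun=> 1%g by apply/funext => -[].
apply: (@zmod_iso_quot _ _ _
  (fun z : cocycle (E_mod t) 0 => coef (z (fun=> 1%g)) : Z2)).
- by [].
- move=> z; split=> [z0|/eqP ->] //.
  by apply/eqP/val_inj/val_inj/funext => g; apply: val_inj; rewrite (pt g).
move=> x; have [c cE] := cochain_of_ucont t_even (@ucont_cst 0 x).
have cz : c \in @is_cocycle _ (E_mod t) 0.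
  apply/eqP/cochain_coef_inj/(@coind_of_inj j).
  rewrite -bar_cochain cE cochain_coef0 coind_of0.
  have -> : coind_of j (fun=> x) = cst0 x.
    by apply/funext => g; rewrite /coind_of /chi j0 expr0z mul1r.
  exact: bar_cst.
by exists (Cocycle cz); rewrite -[LHS]/(cochain_coef c (fun=> 1%g)) cE.
Qed.
End DegreeZero.

(** * Odd internal degrees and the case distinction *)

Lemma cohomology_odd_eq0 (s : nat) (t : int) (x : cohomology (E_mod t) s) :
  ~~ (2 %| t)%Z -> x = 0.
Proof.
move=> t_odd; have E0 (a : E t) : coef a = 0.
  by have := coefP a; rewrite inE (negPf t_odd) => /eqP.
rewrite -[x]reprK; apply/quot_eq0.
have -> : repr x = 0; last exact: rpred0.
by apply/val_inj/val_inj/funext => g; apply: val_inj; apply: E0.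
Qed.

Theorem theorem6p6 (s : nat) (t : int) :
  [/\ t = 0 /\ (s = 0%N \/ s = 1%N) ->
        zmod_iso (cohomology (E_mod t) s) Z2,
      forall (k : nat) (m : int), (1 <= k)%N -> ~~ (2 %| m)%Z ->
        t = 2 ^+ k.+1 * m -> s = 1%N ->
        zmod_iso (cohomology (E_mod t) s) 'Z_(2 ^ k.+2),
      (exists t' : int, t = 4 * t' + 2) /\ s = 1%N ->
        zmod_iso (cohomology (E_mod t) s) 'Z_2,
      (2 <= s)%N /\ (2 %| t)%Z ->
        zmod_iso (cohomology (E_mod t) s) 'Z_2 &
      ~ (t = 0 /\ (s = 0%N \/ s = 1%N)) ->
      ~ (exists (k : nat) (m : int),
           [/\ (1 <= k)%N, ~~ (2 %| m)%Z, t = 2 ^+ k.+1 * m & s = 1%N]) ->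
      ~ ((exists t' : int, t = 4 * t' + 2) /\ s = 1%N) ->
      ~ ((2 <= s)%N /\ (2 %| t)%Z) ->
        forall x : cohomology (E_mod t) s, x = 0].
Proof.
have half (j : int) : t = 2 * j -> (2 %| t)%Z /\ (t %/ 2)%Z = j.
  by move=> ->; rewrite dvdz_mulr // mulrC mulzK.
split.
- case=> t0 [->|->]; first by apply: zmod_iso_cohomology0; rewrite t0.
  have [t_even jE] := half 0 t0.
  apply: zmod_iso_small => //; exact: presents_degree1_Z2.
- move=> k m k0 m_odd tE ->.
  have [t_even jE] : (2 %| t)%Z /\ (t %/ 2)%Z = 2 ^+ k * m.
    by apply: half; rewrite tE exprS mulrA.
  apply: zmod_iso_small => //; exact: presents_degree1_cyclic jE.
- case=> -[t' tE] ->.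
  have [t_even jE] : (2 %| t)%Z /\ (t %/ 2)%Z = 2 * t' + 1.
    by apply: half; rewrite tE; ring.
  apply: zmod_iso_small => //; apply: presents_Z2_quotient; rewrite jE; lia.
- case: s => [|[|s]] [] // _ t_even.
  by apply: zmod_iso_small => //; apply: presents_Z2_quotient.
move=> n1 n2 n3 n4 x; have [t_even|t_odd] := boolP (2 %| t)%Z; last first.
  exact: cohomology_odd_eq0.
have [s0|s1] : s = 0%N \/ s = 1%N.
  case: s n4 {n1 n2 n3 x} => [|[|s]] n4; [by left|by right|by case: n4].
  move: x n1; rewrite s0 => x n1; apply: cohomology0_eq0 => // t0.
  by apply: n1; split=> //; left.
case: (n2); have [t0|/eqP/int_pow2_odd[k [m [m_odd tE]]]] := eqVneq t 0.
  by case: n1; split=> //; right.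
(* Here k is the valuation of t: 0 contradicts evenness, 1 means t = 2 modulo 4, and larger values
   are the cyclic case. *)
case: k tE => [|[|k]] tE.
- by move: t_even m_odd; rewrite tE expr0 mul1r => ->.
- case: n3; split=> //; exists ((m - 1) %/ 2)%Z; lia.
by exists k.+1, m.
Qed.
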